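(* Let $\mathbb{K}$ be a field. The graded vector subspace of $\mathrm{ParQSym}$ spanned by the $M_\pi$ with $\pi$ a partition diagram of propagation number $0$ is a Hopf subalgebra of $\mathrm{ParQSym}$.
   Context: **Partition diagrams.** A partition diagram of order $k\ge 0$ is a set partition of $\{1,\dots,k,1',\dots,k'\}$ ($1,\dots,k$ are the upper nodes, $1',\dots,k'$ the lower nodes); for $k=0$ the only one is the empty diagram $\emptyset$. The propagation number of $\pi$ is the number of blocks of $\pi$ containing at least one upper node and at least one lower node. For $\pi$ of order $k$ and $\rho$ of order $m$, $\pi\otimes\rho$ is the diagram of order $k+m$ whose blocks are the blocks of $\pi$ and the blocks of $\rho$ with labels shifted by $k$ ($i\mapsto i+k$, $i'\mapsto (i+k)'$). If $k,m\ge1$, $\pi\bullet\rho$ is obtained from $\pi\otimes\rho$ by merging the block containing $k'$ with the block containing $(k+1)'$. The empty diagram is the unit for both operations. A diagram is $\otimes$-irreducible if it is not of the form $\rho\otimes\sigma$ with $\rho,\sigma$ both non-empty (so $\emptyset$ is $\otimes$-irreducible). Every non-empty $\pi$ is uniquely $\pi_1\otimes\cdots\otimes\pi_l$ with all $\pi_i$ non-empty and $\otimes$-irreducible. **ParQSym.** $\mathrm{ParQSym}=\bigoplus_{i\ge0}\mathrm{ParQSym}_i$, where $\mathrm{ParQSym}_i$ is the $\mathbb{K}$-vector space with basis $\{M_\pi:\pi\text{ of order }i\}$. Coproduct: $\Delta M_\sigma=\sum_{\pi\otimes\rho=\sigma}M_\pi\otimes M_\rho$, over all ordered pairs of (possibly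 empty) diagrams with $\pi\otimes\rho=\sigma$. Counit: $\varepsilon(M_\pi)=\delta_{\pi,\emptyset}$. Product: $M_\emptyset$ is the unit; for non-empty $\rho=\rho_1\otimes\cdots\otimes\rho_n$, $\sigma=\sigma_1\otimes\cdots\otimes\sigma_m$ with all $\rho_i,\sigma_j$ non-empty $\otimes$-irreducible, $$M_\rho\star M_\sigma=\sum M_{(\rho'_1\bullet\sigma'_1)\otimes\cdots\otimes(\rho'_k\bullet\sigma'_k)},$$ over all $k\in\mathbb{N}$ and all pairs of sequences of diagrams $(\rho'_1,\dots,\rho'_k)$, $(\sigma'_1,\dots,\sigma'_k)$ that become $(\rho_1,\dots,\rho_n)$, respectively $(\sigma_1,\dots,\sigma_m)$, after deleting all empty diagrams, and such that $\rho'_s\bullet\sigma'_s\ne\emptyset$ for all $1\le s\le k$. With these operations $\mathrm{ParQSym}$ is a connected graded bialgebra, hence a Hopf algebra. *)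

(* Defs.v *)
From HB Require Import structures.
From mathcomp Require Import all_boot all_order all_algebra.
From mathcomp Require Import finmap.
From mathcomp.multinomials Require Import monalg.

Set Implicit Arguments.
Unset Strict Implicit.
Unset Printing Implicit Defensive.

Import GRing.Theory.

(* [inl i] is the upper node i+1 and [inr i] the lower node (i+1)'. *)
Definition node (k : nat) : finType := ('I_k + 'I_k)%type.

Definition diagram (k : nat) : Type :=
  {P : {set {set node k}} | partition P [set: node k]}.

(* Diagrams of all orders; the order is the tag. *)
Definition pdiag : Type := {k : nat & diagram k}.

Definition order (p : pdiag) : nat := tag p.
Definition blocks (p : pdiag) : {set {set node (order p)}} := val (tagged p).
Definition mkpdiag k (P : {set {set node k}})
  (hP : partition P [set: node k]) : pdiag :=
  Tagged diagram (Sub P hP : diagram k).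

Definition propagation_number (p : pdiag) : nat :=
  #|[set B in blocks p | [exists i, inl i \in B] && [exists j, inr j \in B]]|.

Lemma empty_partition : partition set0 [set: node 0].
Proof.
have -> : [set: node 0] = set0 by apply/setP; case; case.
by rewrite partition_set0.
Qed.

Definition empty_diag : pdiag := mkpdiag empty_partition.

Definition nodeL k m (x : node k) : node (k + m) :=
  match x with inl i => inl (lshift m i) | inr i => inr (lshift m i) end.
Definition nodeR k m (x : node m) : node (k + m) :=
  match x with inl i => inl (rshift k i) | inr i => inr (rshift k i) end.

Definition tens_blocks k m (P : {set {set node k}}) (Q : {set {set node m}}) :
  {set {set node (k + m)}} :=
  [set @nodeL k m @: B | B : {set node k} in P] :|:
  [set @nodeR k m @: B | B : {set node m} in Q].

Lemma nodeL_inj k m : injective (@nodeL k m).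
Proof. by case=> i [] j //= [] /ord_inj ->. Qed.

Lemma nodeR_inj k m : injective (@nodeR k m).
Proof. by case=> i [] j //= [] /addnI /ord_inj ->. Qed.

Lemma nodeLR k m x y : @nodeL k m x != @nodeR k m y.
Proof.
apply/eqP; case: x y => i [] j //= [] E;
  by have := ltn_ord i; rewrite E ltnNge leq_addr.
Qed.

Lemma nodeP k m (z : node (k + m)) :
  (exists x, z = @nodeL k m x) \/ (exists y, z = @nodeR k m y).
Proof.
case: z => i; rewrite -(splitK i); case: (split i) => j /=.
- by left; exists (inl j).
- by right; exists (inl j).
- by left; exists (inr j).
- by right; exists (inr j).
Qed.

Lemma tens_partition k m (P : {set {set node k}}) (Q : {set {set node m}}) :
  partition P [set: node k] -> partition Q [set: node m] ->
  partition (tens_blocks P Q) [set: node (k + m)].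
Proof.
case/and3P=> /eqP cP /trivIsetP tP nP /and3P[/eqP cQ /trivIsetP tQ nQ].
apply/and3P; split.
- apply/eqP/setP=> z; rewrite !inE; apply/bigcupP.
  case: (nodeP z) => -[x ->].
  + have: x \in cover P by rewrite cP.
    case/bigcupP=> B BP xB; exists (@nodeL k m @: B); last exact: imset_f.
    by rewrite inE; apply/orP; left; apply: imset_f.
  + have: x \in cover Q by rewrite cQ.
    case/bigcupP=> B BP xB; exists (@nodeR k m @: B); last exact: imset_f.
    by rewrite inE; apply/orP; right; apply: imset_f.
- have LR (A : {set node k}) (B : {set node m}) :
    [disjoint @nodeL k m @: A & @nodeR k m @: B].
    apply/pred0P=> z /=; apply/negP=> /andP[/imsetP[x _ ->] /imsetP[y _]].
    by move/eqP; rewrite (negPf (nodeLR x y)).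
  apply/trivIsetP=> A B; rewrite !inE.
  case/orP=> /imsetP[A' hA ->] /orP[] /imsetP[B' hB ->] neq.
  + rewrite imset_disjoint; last by move=> ? ? /nodeL_inj.
    by apply: tP => //; apply: contraNneq neq => ->.
  + exact: LR.
  + by rewrite disjoint_sym; apply: LR.
  + rewrite imset_disjoint; last by move=> ? ? /nodeR_inj.
    by apply: tQ => //; apply: contraNneq neq => ->.
- rewrite inE; apply/norP; split; apply/imsetP=> -[B hB] /esym/eqP;
    rewrite imset_eq0 => /eqP B0; rewrite B0 in hB.
  + by rewrite hB in nP.
  + by rewrite hB in nQ.
Qed.

Definition tens (p q : pdiag) : pdiag :=
  mkpdiag (tens_partition (valP (tagged p)) (valP (tagged q))).

Definition bigtens (s : seq pdiag) : pdiag := foldr tens empty_diag s.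

Definition merge_blocks (T : finType) (x y : T) (P : {set {set T}}) :
  {set {set T}} :=
  (pblock P x :|: pblock P y) |: (P :\: [set pblock P x; pblock P y]).

Lemma merge_partition (T : finType) (x y : T) (P : {set {set T}}) :
  partition P [set: T] -> partition (merge_blocks x y P) [set: T].
Proof.
move=> hP; have [/eqP cP tP nP] := and3P hP.
have xb : x \in pblock P x by rewrite mem_pblock cP.
have xP : pblock P x \in P by rewrite pblock_mem // cP.
have yP : pblock P y \in P by rewrite pblock_mem // cP.
have tP' := trivIsetP tP.
apply/and3P; split.
- apply/eqP/setP=> z; rewrite !inE; apply/bigcupP.
  have zP : pblock P z \in P by rewrite pblock_mem // cP.
  have zb : z \in pblock P z by rewrite mem_pblock cP.
  case: (boolP (pblock P z \in [set pblock P x; pblock P y])) => hz.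
  + exists (pblock P x :|: pblock P y); first by rewrite !inE eqxx.
    by move: hz; rewrite !inE => /orP[] /eqP <-; rewrite zb ?orbT.
  + by exists (pblock P z) => //; rewrite inE in_setD hz zP orbT.
- have dis B : B \in P :\: [set pblock P x; pblock P y] ->
    [disjoint pblock P x :|: pblock P y & B].
    rewrite !inE negb_or => /andP[/andP[Bx By] BP].
    rewrite -setI_eq0 setIUl setU_eq0 !setI_eq0.
    by rewrite !tP' // eq_sym.
  apply/trivIsetP=> A B; rewrite !(in_setU1 _ (_ :|: _)).
  case/orP=> [/eqP->|hA] /orP[/eqP->|hB] neq.
  + by rewrite eqxx in neq.
  + exact: dis.
  + by rewrite disjoint_sym; apply: dis.
  + by move: hA hB; rewrite !in_setD => /andP[_ hA] /andP[_ hB]; apply: tP'.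
- rewrite in_setU1 negb_or in_setD negb_and nP orbT andbT.
  by apply/eqP=> /setP/(_ x); rewrite !inE xb.
Qed.

(* When both orders are positive, k' is the last lower node of the left diagram
   and (k+1)' the first lower node of the right one. *)
Definition bullet (p q : pdiag) : pdiag :=
  match p, q with
  | existT 0 _, _ => q
  | _, existT 0 _ => p
  | existT k.+1 P, existT m.+1 Q =>
      mkpdiag (merge_partition
        (nodeL m.+1 (inr ord_max : node k.+1))
        (nodeR k.+1 (inr ord0 : node m.+1))
        (tens_partition (valP P) (valP Q)))
  end.

(* The diagrams of order at most N form a finite type, which serves to write
   the sums below as finite sums. *)
Definition bdiag (N : nat) : Type := {i : 'I_N.+1 & diagram i}.
Definition pdiag_of_bdiag N (x : bdiag N) : pdiag := Tagged diagram (tagged x).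
Coercion pdiag_of_bdiag : bdiag >-> pdiag.
Definition pdiag2_of_bdiag2 N (x : bdiag N * bdiag N) : pdiag * pdiag :=
  (x.1 : pdiag, x.2 : pdiag).

Lemma bdiagP N (p : pdiag) : order p <= N -> exists x : bdiag N, p = x.
Proof.
case: p => k P; rewrite /order /= -ltnS => kN.
by exists (existT (fun i : 'I_N.+1 => diagram i) (Ordinal kN) P).
Qed.

Lemma order0 (p : pdiag) : order p = 0 -> p = empty_diag.
Proof.
case: p => k P /= k0; rewrite /order /= in k0; subst k.
have S0 (B : {set node 0}) : B = set0 by apply/setP; case; case.
congr existT; apply: val_inj; apply/setP=> B /=.
rewrite in_set0 (S0 B); apply/negbTE.
by case/and3P: (valP P).
Qed.

Definition irreducible (p : pdiag) : bool :=
  [forall x : bdiag (order p) * bdiag (order p),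
    (tens x.1 x.2 == p) ==>
    ((x.1 : pdiag) == empty_diag) || ((x.2 : pdiag) == empty_diag)].

Lemma irreducibleP (p : pdiag) :
  reflect (forall q r, tens q r = p -> q = empty_diag \/ r = empty_diag)
          (irreducible p).
Proof.
apply: (iffP forallP) => [irr q r Ep | irr [x y] /=].
  have [x Ex] : exists x : bdiag (order p), q = x.
    by apply: bdiagP; rewrite -Ep /= leq_addr.
  have [y Ey] : exists y : bdiag (order p), r = y.
    by apply: bdiagP; rewrite -Ep /= leq_addl.
  have := irr (x, y); rewrite /= -Ex -Ey Ep eqxx /=.
  by case/orP=> /eqP ->; [left | right].
by apply/implyP=> /eqP /irr [] ->; rewrite eqxx ?orbT.
Qed.

Definition nonempty (p : pdiag) : bool := p != empty_diag.

(* The sequence of diagrams [s] becomes, after deletion of the empty diagrams,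
   the factorization of [p] into non-empty irreducible diagrams. *)
Definition padded_factorization (s : seq pdiag) (p : pdiag) : bool :=
  all irreducible (filter nonempty s) && (bigtens (filter nonempty s) == p).

Definition bullets (w : seq (pdiag * pdiag)) : seq pdiag :=
  [seq bullet x.1 x.2 | x <- w].

(* [w] is the sequence of the pairs (rho'_s, sigma'_s), s = 1, ..., k. *)
Definition product_index (rho sigma : pdiag) (w : seq (pdiag * pdiag)) : bool :=
  [&& padded_factorization (unzip1 w) rho,
      padded_factorization (unzip2 w) sigma
    & all nonempty (bullets w)].

Lemma order_bigtens (s : seq pdiag) : order (bigtens s) = sumn (map order s).
Proof. by elim: s => //= p s <-. Qed.

Lemma sumn_nonempty (s : seq pdiag) :
  sumn (map order (filter nonempty s)) = sumn (map order s).
Proof.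
elim: s => //= p s <-; rewrite /nonempty.
by case: ifPn => //= /negPn/eqP ->.
Qed.

Lemma bdiag2P N (x : pdiag * pdiag) : order x.1 <= N -> order x.2 <= N ->
  exists y : bdiag N * bdiag N, pdiag2_of_bdiag2 y = x.
Proof.
by case: x => p q /= /bdiagP[x ->] /bdiagP[y ->]; exists (x, y).
Qed.

(* The sequences indexing the sum that defines a product have length at most N
   and consist of diagrams of order at most N, where N is the total order of
   the two factors. *)
Lemma product_index_bound (rho sigma : pdiag) (w : seq (pdiag * pdiag)) :
  product_index rho sigma w ->
  let N := order rho + order sigma in
  size w <= N /\
  exists v : (size w).-tuple (bdiag N * bdiag N),
    w = map (@pdiag2_of_bdiag2 N) v.
Proof.
case/and3P=> /andP[_ /eqP Er] /andP[_ /eqP Es] hne N.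
have EN : N = sumn [seq order x.1 + order x.2 | x <- w].
  rewrite /N -Er -Es !order_bigtens !sumn_nonempty.
  by elim: (w) => //= x t; rewrite addnACA => ->.
split.
  rewrite EN; elim: (w) hne => //= -[p q] t IH /andP[/= ne /IH {}IH].
  rewrite -add1n leq_add // lt0n addn_eq0; apply: contraNN ne.
  by case/andP=> /eqP/order0-> /eqP/order0->.
have {Er Es hne} hN x : x \in w -> order x.1 <= N /\ order x.2 <= N.
  rewrite EN; elim: (w) => //= y t IH; rewrite inE => /predU1P[->|/IH[h1 h2]].
    by rewrite -addnA leq_addr addnCA leq_addr.
  by split; [apply: leq_trans h1 _ | apply: leq_trans h2 _]; apply: leq_addl.
suff [v Ev]: exists v : seq (bdiag N * bdiag N),
    w = map (@pdiag2_of_bdiag2 N) v.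
  have sv : size v == size w by rewrite Ev size_map.
  by exists (Tuple sv).
elim: (w) hN => [|x t IH] hN; first by exists [::].
have [|v ->] := IH; first by move=> y yt; apply: hN; rewrite inE yt orbT.
have [h1 h2] := hN x (mem_head _ _).
by have [y <-] := bdiag2P h1 h2; exists (y :: v).
Qed.

Local Open Scope ring_scope.

Definition ParQSym (K : fieldType) : lmodType K := {malg K[pdiag]}.

(* ParQSym (x) ParQSym, with basis the pairs (p, q) standing for
   M_p (x) M_q. *)
Definition ParQSym2 (K : fieldType) : lmodType K := {malg K[(pdiag * pdiag)%type]}.

Section Operations.
Variable K : fieldType.
Local Notation H := (ParQSym K).
Local Notation HH := (ParQSym2 K).

Definition M (p : pdiag) : H := (<< p >> : {malg K[pdiag]}).
Definition M2 (p q : pdiag) : HH := (<< (p, q) >> : {malg K[(pdiag * pdiag)%type]}).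

Definition linext (B : choiceType) (V : lmodType K) (f : B -> V)
  (v : {malg K[B]}) : V := \sum_(b <- msupp v) v@_b *: f b.

Definition tensor (u v : H) : HH :=
  linext (fun p => linext (fun q => M2 p q) v) u.

Definition coproduct_basis (s : pdiag) : HH :=
  \sum_(x : bdiag (order s) * bdiag (order s) | tens x.1 x.2 == s) M2 x.1 x.2.
Definition coproduct : H -> HH := linext coproduct_basis.

Definition counit : H -> K :=
  linext (V := K^o) (fun p => (p == empty_diag)%:R).

Definition product_basis (rho sigma : pdiag) : H :=
  let N := (order rho + order sigma)%N in
  \sum_(k < N.+1)
    \sum_(v : k.-tuple (bdiag N * bdiag N) |
           product_index rho sigma (map (@pdiag2_of_bdiag2 N) v))
      M (bigtens (bullets (map (@pdiag2_of_bdiag2 N) v))).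
Definition product (u v : H) : H :=
  linext (fun p => linext (fun q => product_basis p q) v) u.

(* product \o (f (x) g) \o coproduct *)
Definition convolution (f g : H -> H) (v : H) : H :=
  linext (fun pq => product (f (M pq.1)) (g (M pq.2))) (coproduct v).

Definition is_antipode (S : H -> H) : Prop :=
  [/\ linear S,
      forall v, convolution S id v = counit v *: M empty_diag
    & forall v, convolution id S v = counit v *: M empty_diag].

Definition span (V : lmodType K) (X : V -> Prop) (v : V) : Prop :=
  exists2 s : seq (K * V), (forall cx, cx \in s -> X cx.2)
                         & v = \sum_(cx <- s) cx.1 *: cx.2.

Definition is_subspace (V : lmodType K) (A : V -> Prop) : Prop :=
  A 0 /\ forall (c : K) u v, A u -> A v -> A (c *: u + v).

Definition tensor_square (A : H -> Prop) : HH -> Prop :=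
  span (fun t => exists u v, [/\ A u, A v & t = tensor u v]).

Definition homogeneous_component (n : nat) : H -> H :=
  linext (fun p => if order p == n then M p else 0).

Definition is_graded_subspace (A : H -> Prop) : Prop :=
  is_subspace A /\ forall n v, A v -> A (homogeneous_component n v).

Definition is_subbialgebra (A : H -> Prop) : Prop :=
  [/\ is_subspace A,
      A (M empty_diag),
      forall u v, A u -> A v -> A (product u v)
    & forall v, A v -> tensor_square A (coproduct v)].

(* The antipode of a bialgebra is unique when it exists. *)
Definition is_Hopf_subalgebra (A : H -> Prop) : Prop :=
  is_subbialgebra A /\
  exists2 S : H -> H, is_antipode S & forall v, A v -> A (S v).

Definition ParQSym_prop0 : H -> Prop :=
  span (fun v => exists2 p, propagation_number p = 0%N & v = M p).

End Operations.

(* Main.v *)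
Require Import Defs.
From HB Require Import structures.
From mathcomp Require Import all_boot all_order all_algebra.
From mathcomp Require Import finmap zify.
From mathcomp.multinomials Require Import monalg.
(* [order] must denote the order of a diagram, not that of [fingraph]. *)
Import Defs.

(** A diagram is encoded by its order and the relation "same block" on
    coordinates [(is_upper, index)], which makes [tens] and [bullet] associative
    by a computation on relations, and makes the diagrams a free monoid for
    [tens]: two factorizations of a diagram have a common refinement. Since a
    cut of [bullet p q] cuts [p] or [q], or separates the merged block, the
    letters (non-empty irreducible diagrams) are closed under [bullet], so that
    ParQSym is a quasi-shuffle algebra on words of letters, with
      [aX * bY = a(X * bY) + b(aX * Y) + (a.b)(X * Y)]
    for letters [a], [b], where [a.b] is [bullet a b], and likewise for last
    letters. The antipode is given by [S(1) = 1], [S(a) = -a] and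
      [S(wzx) = -x S(wz) - S(w(z.x))],
    and [S * id] vanishes on non-empty words by telescoping. Exchanging left and
    right in this recursion gives a right inverse of [id], and both recursions
    define the same map because [bullet] is associative. Propagation number 0
    is inherited by factors, by [tens] and by [bullet] (which merges two blocks
    without upper nodes), hence by products, coproducts and [S]. *)

Set Implicit Arguments.
Unset Strict Implicit.
Unset Printing Implicit Defensive.

Import GRing.Theory.

(** * Diagrams as relations *)

Definition code k (x : node k) : bool * nat :=
  match x with inl i => (true, val i) | inr i => (false, val i) end.

Lemma code_inj k : injective (@code k).
Proof. by move=> [i|i] [j|j] //= [] /val_inj ->. Qed.

Lemma code_lt k (x : node k) : (code x).2 < k.
Proof. by case: x => i /=. Qed.

Lemma code_surj k (u : bool * nat) : u.2 < k -> exists x : node k, code x = u.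
Proof.
case: u => [[] i] /= ik.
  by exists (inl (Ordinal ik)).
by exists (inr (Ordinal ik)).
Qed.

(** The coordinates have one type for all orders, so the relations of two diagrams whose orders are
    equal but not convertible can be compared without casts. *)
Definition same_block (p : pdiag) (u v : bool * nat) : Prop :=
  exists x y : node (order p),
    [/\ code x = u, code y = v & y \in pblock (blocks p) x].

Lemma blocksP (p : pdiag) : partition (blocks p) [set: node (order p)].
Proof. exact: valP (tagged p). Qed.

Lemma cover_blocks (p : pdiag) : cover (blocks p) = [set: node (order p)].
Proof. by case/and3P: (blocksP p) => /eqP. Qed.

Lemma trivIset_blocks (p : pdiag) : trivIset (blocks p).
Proof. by case/and3P: (blocksP p). Qed.

Lemma same_block_code (p : pdiag) (x y : node (order p)) :
  same_block p (code x) (code y) <-> y \in pblock (blocks p) x.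
Proof.
split; last by exists x, y.
by case=> x' [y' [/code_inj -> /code_inj ->]].
Qed.

Lemma same_block_lt (p : pdiag) u v :
  same_block p u v -> u.2 < order p /\ v.2 < order p.
Proof. by case=> x [y [<- <- _]]; rewrite !code_lt. Qed.

Lemma same_block_refl (p : pdiag) u : u.2 < order p -> same_block p u u.
Proof.
case/code_surj => x <-; apply/same_block_code.
by rewrite mem_pblock cover_blocks inE.
Qed.

Lemma same_block_sym (p : pdiag) u v : same_block p u v -> same_block p v u.
Proof.
case=> x [y [<- <- /(same_pblock (trivIset_blocks p)) E]].
by apply/same_block_code; rewrite E mem_pblock cover_blocks inE.
Qed.

Lemma same_block_trans (p : pdiag) u v w :
  same_block p u v -> same_block p v w -> same_block p u w.
Proof.
case=> x [y [<- <- /(same_pblock (trivIset_blocks p)) E]].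
by case=> y' [z [/code_inj -> <- yz]]; apply/same_block_code; rewrite -E.
Qed.

Lemma same_block_ex (p : pdiag) (x y : node (order p)) :
  same_block p (code x) (code y) <->
  exists2 B, B \in blocks p & x \in B /\ y \in B.
Proof.
split=> [/same_block_code xy|[B hB [xB yB]]].
  have xc : x \in cover (blocks p) by rewrite cover_blocks.
  by exists (pblock (blocks p) x); rewrite ?pblock_mem // mem_pblock.
by apply/same_block_code; rewrite (def_pblock (trivIset_blocks p) hB xB).
Qed.

Lemma partition_ext (T : finType) (P Q : {set {set T}}) :
  partition P [set: T] -> partition Q [set: T] ->
  (forall x y, (y \in pblock P x) = (y \in pblock Q x)) -> P = Q.
Proof.
move=> hP hQ E.
suff sub P' Q' : partition P' [set: T] -> partition Q' [set: T] ->
    (forall x y, (y \in pblock P' x) = (y \in pblock Q' x)) -> P' \subset Q'.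
  by apply/eqP; rewrite eqEsubset !sub.
move=> /and3P[_ tP nP] /and3P[/eqP cQ _ _] {}E; apply/subsetP=> B BP.
have [x xB] : exists x, x \in B.
  by apply/set0Pn; apply: contraNneq nP => <-.
rewrite -(def_pblock tP BP xB).
have -> : pblock P' x = pblock Q' x by apply/setP.
by rewrite pblock_mem // cQ.
Qed.

Lemma pdiag_ext (p q : pdiag) : order p = order q ->
  (forall u v, same_block p u v <-> same_block q u v) -> p = q.
Proof.
case: p q => k P [m Q]; rewrite /order /= => E; subst m => h.
congr existT; apply: val_inj; apply: (partition_ext (valP P) (valP Q)).
move=> x y; have := h (code x) (code y).
by rewrite !same_block_code /blocks /= => hh; apply/idP/idP => /hh.
Qed.

Lemma order_tens (p q : pdiag) : order (tens p q) = order p + order q.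
Proof. by []. Qed.

Definition shift (k : nat) (u : bool * nat) := (u.1, k + u.2).
Definition unshift (k : nat) (u : bool * nat) := (u.1, u.2 - k).

Lemma shiftK k : cancel (shift k) (unshift k).
Proof. by case=> b i; rewrite /shift /unshift /= addKn. Qed.

Lemma unshiftK k u : k <= u.2 -> shift k (unshift k u) = u.
Proof. by case: u => b i /= h; rewrite /shift /unshift /= subnKC. Qed.

Lemma code_nodeL k m (x : node k) : code (nodeL m x) = code x.
Proof. by case: x. Qed.
Lemma code_nodeR k m (x : node m) : code (nodeR k x) = shift k (code x).
Proof. by case: x. Qed.

(* [tens] on relations; [k] is the order of the left factor. *)
Definition tens_rel k (P Q : bool * nat -> bool * nat -> Prop) u v : Prop :=
  P u v \/ (k <= u.2) && (k <= v.2) /\ Q (unshift k u) (unshift k v).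

Lemma same_block_tens (p q : pdiag) u v :
  same_block (tens p q) u v
  <-> tens_rel (order p) (same_block p) (same_block q) u v.
Proof.
split.
  case=> x [y [<- <- /same_block_code/same_block_ex[B]]].
  rewrite /blocks /= in_setU => /orP[] /imsetP[C hC ->] [].
    case/imsetP=> x' hx -> /imsetP[y' hy ->]; left; rewrite !code_nodeL.
    by apply/same_block_ex; exists C.
  case/imsetP=> x' hx -> /imsetP[y' hy ->]; right; rewrite !code_nodeR /=.
  rewrite !leq_addr; split=> //; rewrite !shiftK.
  by apply/same_block_ex; exists C.
case=> [[x [y [<- <- /same_block_code/same_block_ex[B hB [xB yB]]]]]|].
  rewrite -(code_nodeL (order q) x) -(code_nodeL (order q) y).
  apply/(same_block_ex (p := tens p q)).
  exists (nodeL (order q) @: B); last by rewrite !imset_f.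
  by rewrite in_setU; apply/orP; left; apply: imset_f.
case=> /andP[hu hv] [x [y [hx hy /same_block_code/same_block_ex[B hB [xB yB]]]]].
rewrite -(unshiftK hu) -(unshiftK hv) -hx -hy -(code_nodeR _ x) -(code_nodeR _ y).
apply/(same_block_ex (p := tens p q)).
exists (@nodeR (order p) _ @: B); last by rewrite !imset_f.
by rewrite in_setU; apply/orP; right; apply: imset_f.
Qed.

Lemma order_empty (p : pdiag) : (order p == 0) = (p == empty_diag).
Proof. by apply/eqP/eqP => [/order0|->]. Qed.

Lemma order_gt0 (p : pdiag) : (0 < order p) = nonempty p.
Proof. by rewrite lt0n order_empty. Qed.

Lemma same_block_empty u v : ~ same_block empty_diag u v.
Proof. by case/same_block_lt. Qed.

Lemma tens0p : left_id empty_diag tens.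
Proof.
move=> p; apply: pdiag_ext => // u v; rewrite same_block_tens /tens_rel /=.
split=> [[/same_block_empty//|[_]]|h]; last right.
  by rewrite /unshift !subn0 -!surjective_pairing.
by rewrite /unshift !subn0 -!surjective_pairing.
Qed.

Lemma tensp0 : right_id empty_diag tens.
Proof.
move=> p; apply: pdiag_ext => [|u v]; first by rewrite order_tens addn0.
rewrite same_block_tens /tens_rel.
by split=> [[//|[_ /same_block_empty//]]|h]; left.
Qed.

Lemma unshiftD k m u : unshift m (unshift k u) = unshift (k + m) u.
Proof. by rewrite /unshift /= subnDA. Qed.

Lemma tensA : associative tens.
Proof.
move=> p q r; apply: pdiag_ext => [|u v]; first by rewrite !order_tens addnA.
rewrite !same_block_tens /tens_rel !same_block_tens /tens_rel.
rewrite !unshiftD order_tens.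
have leE w a b : a <= w.2 -> b <= (unshift a w).2 -> a + b <= w.2.
  by rewrite /=; lia.
have leE' w a b : a + b <= w.2 -> a <= w.2 /\ b <= (unshift a w).2.
  by rewrite /=; lia.
split.
  case=> [h|[/andP[hu hv] [h|[/andP[hu' hv'] h]]]]; first by left; left.
    by left; right; rewrite hu hv.
  by right; split=> //; apply/andP; split; apply: leE.
case=> [[h|[huv h]]|[/andP[hu hv] h]]; first by left.
  by right; split=> //; left.
have [a b] := leE' _ _ _ hu; have [c d] := leE' _ _ _ hv.
by rewrite a b c d; right; split=> //; right.
Qed.

Lemma same_block_tensL (p q : pdiag) u v : u.2 < order p ->
  same_block (tens p q) u v <-> same_block p u v.
Proof.
move=> hu; rewrite same_block_tens /tens_rel; split=> [[//|[/andP[]]]|]; last by left.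
by rewrite leqNgt hu.
Qed.

Lemma same_block_tensR (p q : pdiag) u v :
  same_block (tens p q) (shift (order p) u) (shift (order p) v)
  <-> same_block q u v.
Proof.
rewrite same_block_tens /tens_rel !shiftK /= !leq_addr.
split=> [[/same_block_lt/=[]|[_]//]|]; last by right.
by rewrite ltnNge leq_addr.
Qed.

Lemma tens_inj (p q p' q' : pdiag) : order p = order p' ->
  tens p q = tens p' q' -> p = p' /\ q = q'.
Proof.
move=> ho E; have ho' : order q = order q'.
  by have := congr1 order E; rewrite !order_tens ho => /addnI.
split; apply: pdiag_ext => // u v.
  split=> h; have [hu _] := same_block_lt h.
    by apply/(@same_block_tensL p' q'); rewrite -?ho // -E same_block_tensL.
  by apply/(@same_block_tensL p q); rewrite ?ho // E same_block_tensL.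
by rewrite -(same_block_tensR p) E ho same_block_tensR.
Qed.

(** * Vertical cuts, and Levi's lemma for [tens] *)

Definition cuts (j : nat) (p : pdiag) : Prop :=
  forall u v, same_block p u v -> (u.2 < j) = (v.2 < j).

Lemma cuts_tens (p q : pdiag) : cuts (order p) (tens p q).
Proof.
move=> u v; rewrite same_block_tens => -[/same_block_lt[-> ->] //|[/andP[hu hv] _]].
by rewrite !ltnNge hu hv.
Qed.

(** The relation of [p] is pulled back along [f]; the hypothesis on [f] keeps it reflexive. With [f]
    the identity or [shift j] this produces the two sides of a cut. *)
Lemma restriction (p : pdiag) (f : bool * nat -> bool * nat) k :
    (forall u, u.2 < k -> (f u).2 < order p) ->
  exists2 q, order q = k & forall u v,
    same_block q u v <-> [/\ u.2 < k, v.2 < k & same_block p (f u) (f v)].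
Proof.
move=> hf; pose R (x y : node k) :=
  [exists a : node (order p), [exists b : node (order p),
    [&& code a == f (code x), code b == f (code y) & b \in pblock (blocks p) a]]].
have RP x y : reflect (same_block p (f (code x)) (f (code y))) (R x y).
  apply: (iffP existsP) => [[a /existsP[b /and3P[/eqP <- /eqP <- h]]]|].
    by apply/same_block_code.
  by case=> a [b [<- <- h]]; exists a; apply/existsP; exists b; rewrite !eqxx.
have Req : {in [set: node k] & &, equivalence_rel R}.
  move=> x y z _ _ _; split; first by apply/RP/same_block_refl/hf/code_lt.
  move/RP=> xy; apply/RP/RP => h; last exact: same_block_trans xy h.
  by apply: same_block_trans h; apply: same_block_sym.
exists (mkpdiag (equivalence_partitionP Req)) => // u v.
split=> [[x [y [<- <-]]]|[/code_surj[x <-] /code_surj[y <-] h]].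
  rewrite /blocks /= pblock_equivalence_partition ?inE // => /RP h.
  by rewrite !code_lt.
exists x, y; split=> //.
by rewrite /blocks /= pblock_equivalence_partition ?inE //; apply/RP.
Qed.

Lemma cuts_split (p : pdiag) j : j <= order p -> cuts j p ->
  exists a b, order a = j /\ p = tens a b.
Proof.
move=> hj cj.
have [u|a oa Ra] := @restriction p id j; first by move/leq_trans; apply.
have [u|b ob Rb] := @restriction p (shift j) (order p - j).
  by rewrite /shift /=; lia.
exists a, b; split=> //; apply: pdiag_ext => [|u v].
  by rewrite order_tens oa ob subnKC.
rewrite same_block_tens /tens_rel Ra Rb oa; split.
  move=> h; have [hu hv] := same_block_lt h; have := cj _ _ h.
  case: (ltnP u.2 j) => hu' /esym; first by left.
  move/negbT; rewrite -leqNgt => hv'; right; rewrite hv'.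
  by rewrite !unshiftK //=; split=> //; split=> //; lia.
by case=> [[]//|[/andP[hu hv] [_ _]]]; rewrite !unshiftK.
Qed.

(** The cut between [p] and [q] is also a cut of [p'], whose relation is part of that of
    [tens p' q']. Splitting [p'] there gives the common refinement. *)
Lemma tens_levi (p q p' q' : pdiag) : order p <= order p' ->
  tens p q = tens p' q' -> exists r, p' = tens p r /\ q = tens r q'.
Proof.
move=> ho E; have [|a [r [oa Ep]]] := cuts_split ho.
  move=> u v h; apply: (@cuts_tens p q); rewrite E.
  by rewrite same_block_tens; left.
subst p'; rewrite -tensA in E.
by have [-> ->] := tens_inj (esym oa) E; exists r.
Qed.

(* A partition relation with the blocks of [x] and [y] merged. *)
Definition merge_rel (x y : bool * nat) (P : bool * nat -> bool * nat -> Prop)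
    u v : Prop :=
  P u v \/ (P u x /\ P y v \/ P u y /\ P x v).

Lemma same_block_merge (p : pdiag) (x y : node (order p)) u v :
  same_block (mkpdiag (merge_partition x y (blocksP p))) u v
  <-> merge_rel (code x) (code y) (same_block p) u v.
Proof.
have sc z t : reflect (same_block p (code z) (code t)) (t \in pblock (blocks p) z).
  by apply: (iffP idP) => /same_block_code.
have rfl (z : node (order p)) : z \in pblock (blocks p) z.
  by rewrite mem_pblock cover_blocks.
split.
  case=> a [b [<- <-]].
  move/same_block_code/same_block_ex => [B].
  rewrite /blocks /= in_setU1 => /orP[/eqP -> []|].
    rewrite !in_setU => /orP[] /sc ha /orP[] /sc hb.
    - by left; apply: same_block_trans (same_block_sym ha) hb.
    - by right; left; split=> //; apply: same_block_sym.
    - by right; right; split=> //; apply: same_block_sym.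
    - by left; apply: same_block_trans (same_block_sym ha) hb.
  by rewrite in_setD => /andP[_ hB] [aB bB]; left; apply/same_block_ex; exists B.
have mg a b : a \in pblock (blocks p) x :|: pblock (blocks p) y ->
    b \in pblock (blocks p) x :|: pblock (blocks p) y ->
    same_block (mkpdiag (merge_partition x y (blocksP p))) (code a) (code b).
  move=> ha hb; apply/(same_block_ex (p := mkpdiag _)).
  by exists (pblock (blocks p) x :|: pblock (blocks p) y); rewrite ?in_setU1 ?eqxx.
case=> [[a [b [<- <- ab]]]|
  [] [[a [x' [<- /code_inj Ex ax]]] [y' [b [/code_inj Ey <- yb]]]]]; last 2 first.
- by apply: mg; rewrite in_setU; apply/orP; [left|right];
    apply/sc; rewrite -?Ex -?Ey; first (apply: same_block_sym); apply/sc.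
- by apply: mg; rewrite in_setU; apply/orP; [right|left];
    apply/sc; rewrite -?Ex -?Ey; first (apply: same_block_sym); apply/sc.
(* The block of [a] either is one of the two merged blocks or survives unchanged. *)
case: (boolP (pblock (blocks p) a
              \in [set pblock (blocks p) x; pblock (blocks p) y])) => hz.
  by apply: mg; move: hz; rewrite !inE => /orP[] /eqP <-; rewrite ?rfl ?ab ?orbT.
apply/(same_block_ex (p := mkpdiag _)); exists (pblock (blocks p) a) => //.
by rewrite /blocks /= in_setU1 in_setD hz /= pblock_mem ?orbT // cover_blocks.
Qed.

Lemma bullet0p : left_id empty_diag bullet.
Proof. by []. Qed.

Lemma bulletp0 : right_id empty_diag bullet.
Proof.
move=> p; have [/eqP|] := boolP (order p == 0); first by move/order0 ->.
by case: p => [[|k] P].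
Qed.

Lemma order_bullet (p q : pdiag) : order (bullet p q) = order p + order q.
Proof.
case: p q => [[|k] P] [[|m] Q] //=.
by rewrite /order /= addn0.
Qed.

(** Indices start at 0, so the last lower node of [p] has index [(order p).-1] and the first lower
    node of [q] is moved to index [order p]. *)
Lemma same_block_bullet (p q : pdiag) u v : nonempty p -> nonempty q ->
  same_block (bullet p q) u v <->
  merge_rel (false, (order p).-1) (false, order p) (same_block (tens p q)) u v.
Proof.
rewrite -!order_gt0; case: p q => [[|k] P] [[|m] Q] // _ _.
rewrite /order /=.
have := @same_block_merge (tens (existT diagram k.+1 P) (existT diagram m.+1 Q))
  (nodeL m.+1 (inr ord_max : node k.+1)) (nodeR k.+1 (inr ord0 : node m.+1)) u v.
rewrite code_nodeL code_nodeR /= /shift /= addn0 => <-.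
by rewrite /same_block.
Qed.

(** * Associativity and irreducibility of bullet, factorizations *)

(** Partial equivalence relations: [same_block p] is reflexive only at indices below [order p]. *)
Definition per_rel (T : Type) (P : T -> T -> Prop) : Prop :=
  (forall u v, P u v -> P v u) /\ (forall u v w, P u v -> P v w -> P u w).

Lemma per_same_block (p : pdiag) : per_rel (same_block p).
Proof. by split; [apply: same_block_sym | apply: same_block_trans]. Qed.

Lemma per_merge x y P : per_rel P -> P x x -> P y y ->
  per_rel (merge_rel x y P).
Proof. by rewrite /per_rel /merge_rel => -[s t] hx hy; split; firstorder. Qed.

(** Minimality of the merge: it lies in every partial equivalence relation that contains [P] and
    relates [x] to [y]. *)
Lemma merge_relS x y (P Q : bool * nat -> bool * nat -> Prop) : per_rel Q ->
  (forall u v, P u v -> Q u v) -> Q x y ->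
  forall u v, merge_rel x y P u v -> Q u v.
Proof.
move=> [s t] PQ xy u v [/PQ//|[[/PQ ux /PQ yv]|[/PQ uy /PQ xv]]].
  exact: t (t _ _ _ ux xy) yv.
exact: t (t _ _ _ uy (s _ _ xy)) xv.
Qed.

Lemma merge_rel_id x y P : P x x -> P y y -> merge_rel x y P x y.
Proof. by move=> hx hy; right; left. Qed.

(** Two uses of minimality give one inclusion, and the other follows by exchanging the two pairs. *)
Lemma merge_relC x y z t P : per_rel P ->
    P x x -> P y y -> P z z -> P t t -> forall u v,
  merge_rel x y (merge_rel z t P) u v <-> merge_rel z t (merge_rel x y P) u v.
Proof.
move=> pP; wlog suff sub : x y z t / P x x -> P y y -> P z z -> P t t ->
    forall u v, merge_rel x y (merge_rel z t P) u v ->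
    merge_rel z t (merge_rel x y P) u v.
  by move=> hx hy hz ht u v; split; apply: sub.
move=> hx hy hz ht; have pxy := per_merge pP hx hy.
have xyP u : P u u -> merge_rel x y P u u by left.
apply: merge_relS; first by apply: per_merge; rewrite // ?xyP //; apply: xyP.
  apply: merge_relS; first by apply: per_merge => //; apply: xyP.
    by move=> u v h; left; left.
  by apply: merge_rel_id; apply: xyP.
by left; apply: merge_rel_id.
Qed.

(** For non-empty factors both sides are the threefold [tens] with its two junctions merged, in
    opposite orders, and [merge_relC] exchanges the merges. [EL] and [ER] move the inner merge out
    of [tens]. *)
Lemma bulletA : associative bullet.
Proof.
move=> p q r.
have [hp|] := boolP (nonempty p); last by move/negPn/eqP ->.
have [hq|] := boolP (nonempty q); last first.
  by move/negPn/eqP ->; rewrite bulletp0.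
have [hr|] := boolP (nonempty r); last first.
  by move/negPn/eqP ->; rewrite !bulletp0.
have hpq : nonempty (bullet p q) by move: hp; rewrite -!order_gt0 order_bullet; lia.
have hqr : nonempty (bullet q r) by move: hq; rewrite -!order_gt0 order_bullet; lia.
apply: pdiag_ext => [|u v]; first by rewrite !order_bullet addnA.
rewrite !same_block_bullet // order_bullet.
move: hp hq hr; rewrite -!order_gt0 => hp hq hr.
set k := order p; set m := order q.
pose T := same_block (tens (tens p q) r).
have Tref b i : i < k + m + order r -> T (b, i) (b, i).
  by move=> h; apply: same_block_refl; rewrite !order_tens.
have EL u1 v1 : same_block (tens p (bullet q r)) u1 v1 <->
    merge_rel (false, (k + m).-1) (false, k + m) T u1 v1.
  rewrite /T -tensA !same_block_tens /tens_rel same_block_bullet -?order_gt0 //.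
  rewrite /merge_rel !(same_block_tens p) /tens_rel -/k -/m /=.
  have -> : k <= (k + m).-1 by lia.
  have -> : k <= k + m by lia.
  rewrite /unshift /= addKn.
  have -> : (k + m).-1 - k = m.-1 by lia.
  (* The junction of [q] and [r] lies at indices at least [k], out of reach of [p]. *)
  have n1 w i : k <= i -> same_block p w (false, i) <-> False.
    by move=> h; split=> // /same_block_lt[_ /=]; lia.
  have n2 w i : k <= i -> same_block p (false, i) w <-> False.
    by move=> h; split=> // /same_block_lt[/=]; lia.
  rewrite !n1 ?n2; try lia.
  by case: (k <= u1.2); case: (k <= v1.2) => /=; intuition.
have ER u1 v1 : same_block (tens (bullet p q) r) u1 v1 <->
    merge_rel (false, k.-1) (false, k) T u1 v1.
  rewrite same_block_tens /tens_rel same_block_bullet -?order_gt0 //.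
  rewrite order_bullet /merge_rel /T !(same_block_tens (tens p q)) /tens_rel.
  rewrite order_tens -/k -/m /=.
  have -> : (k + m <= k.-1) = false by lia.
  have -> : (k + m <= k) = false by lia.
  by rewrite !andbF; intuition.
have per_T : per_rel T by apply: per_same_block.
have mrE x y P Q : (forall u v, P u v <-> Q u v) ->
    merge_rel x y P u v <-> merge_rel x y Q u v.
  by move=> E; rewrite /merge_rel !E.
rewrite (mrE _ _ _ _ EL) (mrE _ _ _ _ ER).
by apply: merge_relC => //; apply: Tref; rewrite -/k -/m; lia.
Qed.

Lemma cuts_reducible (p : pdiag) j : 0 < j < order p -> cuts j p ->
  ~~ irreducible p.
Proof.
case/andP=> j0 jp /(cuts_split (ltnW jp)) [a [b [oa E]]].
apply/irreducibleP => /(_ a b (esym E)) [] h.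
  by rewrite -oa h in j0.
by rewrite E h order_tens addn0 oa ltnn in jp.
Qed.

Lemma irreducible_bullet (p q : pdiag) :
  irreducible p -> irreducible q -> irreducible (bullet p q).
Proof.
have [hp|] := boolP (nonempty p); last by move/negPn/eqP ->.
have [hq|] := boolP (nonempty q); last by move/negPn/eqP ->; rewrite bulletp0.
move=> ip iq; apply/irreducibleP => a b E.
have [|na] := eqVneq a empty_diag; first by left.
have [|nb] := eqVneq b empty_diag; first by right.
have cab : cuts (order a) (bullet p q) by rewrite -E; apply: cuts_tens.
have oE : order a + order b = order p + order q by rewrite -(order_bullet p q) -E.
have {}na : 0 < order a by rewrite order_gt0.
have {}nb : 0 < order b by rewrite order_gt0.
have cut u v : same_block (tens p q) u v -> (u.2 < order a) = (v.2 < order a).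
  by move=> h; apply: cab; apply/same_block_bullet => //; left.
(* The cut lies left of the junction, right of it, or exactly at it; in the last case it separates
   the two merged nodes. *)
have [lt|gt|eq] := ltngtP (order a) (order p).
- suff: ~~ irreducible p by rewrite ip.
  apply: (@cuts_reducible p (order a)); rewrite ?na ?lt //.
  by move=> u v h; apply: cut; rewrite same_block_tens; left.
- suff: ~~ irreducible q by rewrite iq.
  apply: (@cuts_reducible q (order a - order p)); first lia.
  move=> u v h; have := cut (shift (order p) u) (shift (order p) v).
  by rewrite same_block_tensR /shift /= => /(_ h); rewrite !ltn_subRL.
- have h : same_block (bullet p q) (false, (order p).-1) (false, order p).
    apply/same_block_bullet => //; apply: merge_rel_id;
      apply: same_block_refl; rewrite order_tens /=; lia.
  by have := cab _ _ h; rewrite /= eq ltnn; lia.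
Qed.

Lemma nonempty_bullet (p q : pdiag) :
  nonempty (bullet p q) = nonempty p || nonempty q.
Proof. by rewrite -!order_gt0 order_bullet addn_gt0. Qed.

Lemma nonempty_empty : nonempty empty_diag = false.
Proof. by rewrite /nonempty eqxx. Qed.

(** [irreducible] holds of the empty diagram, which must not count as a letter. *)
Definition letter (p : pdiag) : bool := nonempty p && irreducible p.

Lemma letter_bullet (p q : pdiag) : letter p -> letter q -> letter (bullet p q).
Proof.
rewrite /letter nonempty_bullet => /andP[-> ip] /andP[_ iq].
by rewrite irreducible_bullet.
Qed.

(** * Unique factorization into letters *)

Lemma bigtens_cat (s t : seq pdiag) :
  bigtens (s ++ t) = tens (bigtens s) (bigtens t).
Proof. by elim: s => /= [|a s ->]; rewrite ?tens0p ?tensA. Qed.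

Lemma tens_eq0 (p q : pdiag) : tens p q = empty_diag ->
  p = empty_diag /\ q = empty_diag.
Proof.
move/(congr1 order); rewrite order_tens => /eqP; rewrite addn_eq0 !order_empty.
by case/andP=> /eqP-> /eqP->.
Qed.

(** By [tens_levi] one of [a], [b] is a prefix of the other; if [b] were strictly shorter, it would
    be a proper non-empty factor of the irreducible [a]. *)
Lemma letter_prefix (a p b q : pdiag) : letter a -> nonempty b ->
  tens a p = tens b q -> exists r, b = tens a r /\ p = tens r q.
Proof.
case/andP=> na ia nb E.
have [/tens_levi/(_ E)//|lt] := leqP (order a) (order b).
have [r [Ea Eq]] := tens_levi (ltnW lt) (esym E).
move/irreducibleP: ia => /(_ b r (esym Ea)) [] h; first by rewrite h nonempty_empty in nb.
by rewrite Ea h order_tens addn0 ltnn in lt.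
Qed.

Lemma bigtens_letter_inj (s t : seq pdiag) : all letter s -> all letter t ->
  bigtens s = bigtens t -> s = t.
Proof.
elim: s t => [|a s IH] [|b t] //=.
- by move=> _ /andP[/andP[nb _] _] /esym/tens_eq0[b0]; rewrite b0 nonempty_empty in nb.
- by move=> /andP[/andP[na _] _] _ /tens_eq0[a0]; rewrite a0 nonempty_empty in na.
move=> /andP[la ls] /andP[lb lt] E.
have [nb ib] := andP lb; have [na _] := andP la.
have [r [Eb _]] := letter_prefix la nb E.
have r0 : r = empty_diag.
  by have [h|//] := irreducibleP _ ib _ _ (esym Eb); rewrite h nonempty_empty in na.
move: Eb; rewrite r0 tensp0 => Eb; subst b.
by case: (tens_inj erefl E) => _ /IH ->.
Qed.

(** Induction on the order: a reducible diagram splits into two factors of smaller order. The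
    condition is boolean so that [xchoose] can pick a factorization. *)
Lemma factorization_ex (p : pdiag) :
  exists s, all letter s && (bigtens s == p).
Proof.
have [n] := ubnP (order p); elim: n p => // n IH p hn.
have [np|/negPn/eqP ->] := boolP (nonempty p); last by exists [::] => /=.
have [ip|] := boolP (irreducible p).
  by exists [:: p]; rewrite /= /letter np ip tensp0 eqxx.
case/forallPn => -[a b] /=.
move: (@pdiag_of_bdiag (order p) a) (@pdiag_of_bdiag (order p) b) => x y.
rewrite negb_imply negb_or => /and3P[/eqP E nx ny].
have oE : order x + order y = order p by rewrite -E.
rewrite -order_empty -lt0n in nx; rewrite -order_empty -lt0n in ny.
have [|s /andP[ls /eqP Es]] := IH x; first lia.
have [|t /andP[lt /eqP Et]] := IH y; first lia.
by exists (s ++ t); rewrite all_cat ls lt bigtens_cat Es Et E eqxx.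
Qed.

Fact factorization_sig (p : pdiag) : {s | all letter s & bigtens s = p}.
Proof.
by exists (xchoose (factorization_ex p));
  case/andP: (xchooseP (factorization_ex p)) => // _ /eqP.
Qed.

Definition factorization (p : pdiag) : seq pdiag := s2val (factorization_sig p).

Lemma factorization_letter (p : pdiag) : all letter (factorization p).
Proof. by rewrite /factorization; case: factorization_sig. Qed.

Lemma factorizationK : cancel factorization bigtens.
Proof. by move=> p; rewrite /factorization; case: factorization_sig. Qed.

Lemma bigtensK (s : seq pdiag) : all letter s -> factorization (bigtens s) = s.
Proof.
by move=> ls; apply: bigtens_letter_inj; rewrite ?factorization_letter ?factorizationK.
Qed.

(** By uniqueness, [s] is the concatenation of the factorizations of [p] and [q]. This makes the
    coproduct the deconcatenation of words. *)
Lemma tens_eq_bigtens (p q : pdiag) (s : seq pdiag) : all letter s ->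
  tens p q = bigtens s <->
  exists2 i, i <= size s & p = bigtens (take i s) /\ q = bigtens (drop i s).
Proof.
move=> ls; split=> [E|[i _ [-> ->]]]; last by rewrite -bigtens_cat cat_take_drop.
have Es : s = factorization p ++ factorization q.
  apply: bigtens_letter_inj => //; first by rewrite all_cat !factorization_letter.
  by rewrite bigtens_cat !factorizationK.
exists (size (factorization p)); rewrite Es ?size_cat ?leq_addr //.
by rewrite take_size_cat // drop_size_cat // !factorizationK.
Qed.

(** * Stability of propagation number 0 *)

Lemma propagation0P (p : pdiag) : propagation_number p = 0 <->
  forall i j, ~ same_block p (true, i) (false, j).
Proof.
split=> [/eqP|h].
  rewrite cards_eq0 => /eqP/setP E i j [a [b []]].
  case: a => x //= _; case: b => y //= _ xy.
  have := E (pblock (blocks p) (inl x)); rewrite !inE => /negbT/negP; apply.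
  have xc : (inl x : node (order p)) \in cover (blocks p).
    by rewrite cover_blocks in_setT.
  apply/and3P; split; first exact: pblock_mem.
    by apply/existsP; exists x; rewrite mem_pblock.
  by apply/existsP; exists y.
apply/eqP; rewrite cards_eq0; apply/eqP/setP=> B; rewrite !inE.
apply/negbTE/negP=> /and3P[hB /existsP[i iB] /existsP[j jB]].
by apply: (h i j); apply/(@same_block_ex p (inl i) (inr j)); exists B.
Qed.

Lemma propagation0_empty : propagation_number empty_diag = 0.
Proof. by apply/propagation0P => i j /same_block_empty. Qed.

Lemma propagation0_tens (p q : pdiag) : propagation_number (tens p q) = 0 <->
  propagation_number p = 0 /\ propagation_number q = 0.
Proof.
rewrite !propagation0P; split=> [h|[hp hq] i j].
  split=> i j hij; first by apply: (h i j); rewrite same_block_tens; left.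
  apply: (h (order p + i) (order p + j)).
  exact/(same_block_tensR p q (true, i) (false, j)).
by rewrite same_block_tens => -[/hp//|[_ /hq]].
Qed.

Lemma propagation0_bullet (p q : pdiag) :
  propagation_number p = 0 -> propagation_number q = 0 ->
  propagation_number (bullet p q) = 0.
Proof.
have [np|] := boolP (nonempty p); last by move/negPn/eqP ->.
have [nq|] := boolP (nonempty q); last by move/negPn/eqP ->; rewrite bulletp0.
move=> hp hq; have /propagation0P h : propagation_number (tens p q) = 0.
  by rewrite propagation0_tens.
(* A relation through the junction would already link the upper node to a lower junction node in
   [tens p q]. *)
by apply/propagation0P => i j /same_block_bullet => /(_ np nq) [/h|[] [/h]].
Qed.

Lemma propagation0_bigtens (s : seq pdiag) :
  propagation_number (bigtens s) = 0 <->
  forall p, p \in s -> propagation_number p = 0.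
Proof.
elim: s => [|a s IH] /=; first by split=> // _; apply: propagation0_empty.
rewrite propagation0_tens IH; split=> [[ha hs] p|h].
  by rewrite inE => /predU1P[->|/hs].
by split=> [|p ps]; apply: h; rewrite inE ?eqxx ?ps ?orbT.
Qed.

(** * Index sets of products and coproducts *)

(** Replaces a sum over a bounded finite type by a sum over an explicit list, which frees it from
    the bound. *)
Lemma sum_reindex_seq (T : finType) (S : eqType) (V : nmodType) (f : T -> S)
    (P : pred S) (F : S -> V) (L : seq S) :
    injective f -> uniq L -> (forall w, (w \in L) = P w) ->
    (forall w, P w -> exists t, w = f t) ->
  (\sum_(t | P (f t)) F (f t) = \sum_(w <- L) F w)%R.
Proof.
move=> f_inj uL memL imL.
rewrite -(big_map f P F) -big_filter; apply: perm_big; apply: uniq_perm => //.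
  by rewrite filter_uniq // map_inj_uniq // index_enum_uniq.
move=> w; rewrite mem_filter memL; case: (boolP (P w)) => //= /imL [t ->].
by rewrite map_f // mem_index_enum.
Qed.

Lemma sum_tuples_seq (T : finType) (S : eqType) (V : nmodType) (f : T -> S) N
    (P : pred (seq S)) (F : seq S -> V) (L : seq (seq S)) :
    injective f -> uniq L -> (forall w, (w \in L) = P w) ->
    (forall w, P w -> size w <= N /\ exists v : (size w).-tuple T, w = map f v) ->
  (\sum_(k < N.+1) \sum_(v : k.-tuple T | P (map f v)) F (map f v)
   = \sum_(w <- L) F w)%R.
Proof.
move=> f_inj uL memL imL.
have -> : (\sum_(w <- L) F w =
    \sum_(k < N.+1) \sum_(w <- L | size w == k) F w)%R.
  (* [inord] does not change the size here, since [imL] bounds the sizes of the members of [L] by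
     [N]. *)
  rewrite big_seq (partition_big (fun w => inord (size w) : 'I_N.+1) xpredT) //=.
  apply: eq_bigr => k _; rewrite [RHS]big_seq_cond; apply: eq_bigl => w.
  case wL: (w \in L) => //=; rewrite -val_eqE /= inordK //.
  by move: wL; rewrite memL ltnS => /imL[].
apply: eq_bigr => k _; rewrite -[RHS]big_filter.
transitivity (\sum_(v : k.-tuple T | P (map f v) && (size (map f v) == k))
    F (map f v))%R.
  by apply: eq_bigl => v; rewrite size_map size_tuple eqxx andbT.
apply: (@sum_reindex_seq _ _ _ (fun v : k.-tuple T => map f v)
          (fun w => P w && (size w == k)) F).
- by move=> u v /(inj_map f_inj) /val_inj.
- exact: filter_uniq.
- by move=> w; rewrite mem_filter memL andbC.
move=> w /andP[/imL[_ [v Ew]] /eqP wk].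
by exists (tcast wk v); rewrite val_tcast.
Qed.

(* The pairs of sequences [(rho'_1, sigma'_1), ..., (rho'_k, sigma'_k)] indexing
   the product of the diagrams with factorizations [r] and [s]. *)
Fixpoint paddings (r : seq pdiag) : seq pdiag -> seq (seq (pdiag * pdiag)) :=
  fix paddings_r (s : seq pdiag) :=
  match r, s with
  | [::], [::] => [:: [::]]
  | [::], b :: s' => map (cons (empty_diag, b)) (paddings_r s')
  | a :: r', [::] => map (cons (a, empty_diag)) (paddings r' [::])
  | a :: r', b :: s' =>
      map (cons (a, empty_diag)) (paddings r' s)
      ++ map (cons (empty_diag, b)) (paddings_r s')
      ++ map (cons (a, b)) (paddings r' s')
  end.

Lemma paddings0c b s :
  paddings [::] (b :: s) = map (cons (empty_diag, b)) (paddings [::] s).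
Proof. by []. Qed.

Lemma paddingsc0 a r :
  paddings (a :: r) [::] = map (cons (a, empty_diag)) (paddings r [::]).
Proof. by []. Qed.

Lemma paddingscc a r b s : paddings (a :: r) (b :: s) =
  map (cons (a, empty_diag)) (paddings r (b :: s))
  ++ map (cons (empty_diag, b)) (paddings (a :: r) s)
  ++ map (cons (a, b)) (paddings r s).
Proof. by []. Qed.

Definition is_padding (r s : seq pdiag) (w : seq (pdiag * pdiag)) : bool :=
  [&& filter nonempty (unzip1 w) == r, filter nonempty (unzip2 w) == s
    & all (fun x => nonempty x.1 || nonempty x.2) w].

Lemma mem_map_cons (T : eqType) (c x : T) (w : seq T) (L : seq (seq T)) :
  (x :: w \in map (cons c) L) = (x == c) && (w \in L).
Proof.
apply/mapP/andP => [[w' hw [-> ->]]|[/eqP -> hw]]; first by rewrite eqxx.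
by exists w.
Qed.

Lemma nil_map_cons (T : eqType) (c : T) (L : seq (seq T)) :
  ([::] \in map (cons c) L) = false.
Proof. by apply/negP => /mapP[]. Qed.

(** Induction on [w]: which components of its first pair are empty decides which of the sublists of
    [paddings] can contain [w]. *)
Lemma mem_paddings (r s : seq pdiag) w : all nonempty r -> all nonempty s ->
  (w \in paddings r s) = is_padding r s w.
Proof.
elim: w r s => [|[x y] w IH] r s hr hs.
  case: r s {hr hs} => [|a r] [|b s];
  by rewrite /is_padding /= ?mem_cat ?nil_map_cons ?andbF ?eqxx.
have {}IH r' s' : all nonempty r' -> all nonempty s' ->
  (w \in paddings r' s') = is_padding r' s' w by apply: IH.
have neq z c : nonempty z -> nonempty c = false -> (z == c) = false.
  by move=> nz nc; apply/eqP => E; rewrite -E nz in nc.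
have neq' z c : nonempty z = false -> nonempty c -> (z == c) = false.
  by move=> nz nc; apply/eqP => E; rewrite E nc in nz.
have eqe z : nonempty z = false -> (z == empty_diag) by move/negbFE.
case: r hr => [_|a r /andP[na hr]]; case: s hs => [_|b s /andP[nb hs]].
- rewrite inE /= /is_padding /=.
  by case nx: (nonempty x); case ny: (nonempty y); rewrite ?andbF.
- rewrite paddings0c mem_map_cons IH //= ?nb // /is_padding /= xpair_eqE.
  case nx: (nonempty x); rewrite /= ?andbF.
    by rewrite (neq x) ?nonempty_empty.
  rewrite eqe //=; case ny: (nonempty y); rewrite /= ?andbF ?eqseq_cons.
    by case: (y == b); rewrite ?andbF.
  by rewrite (neq' y).
- rewrite paddingsc0 mem_map_cons IH //= ?na // /is_padding /= xpair_eqE.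
  case ny: (nonempty y); rewrite /= ?andbF.
    by rewrite (neq y) ?nonempty_empty ?andbF.
  rewrite (eqe y) //=; case nx: (nonempty x); rewrite /= ?andbF ?eqseq_cons.
    by case: (x == a); rewrite ?andbF.
  by rewrite (neq' x).
rewrite paddingscc !mem_cat !mem_map_cons !IH //= ?na ?nb //.
rewrite !xpair_eqE /is_padding /=.
case nx: (nonempty x); case ny: (nonempty y) => /=; rewrite ?eqseq_cons.
- rewrite (neq x empty_diag) ?(neq y empty_diag) ?nonempty_empty //= ?andbF.
  by case: (x == a); case: (y == b); rewrite ?andbF.
- rewrite (neq x empty_diag) ?(neq' y b) ?nonempty_empty // eqe //= !andbF !orbF andbT.
  by case: (x == a); rewrite ?andbF.
- rewrite (neq' x a) ?(neq y empty_diag) ?nonempty_empty // eqe //=.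
  by case: (y == b); rewrite ?andbF ?orbF.
- by rewrite (neq' x a) ?(neq' y b) ?andbF.
Qed.

(** The three sublists are disjoint because their first pairs differ, [a] and [b] being
    non-empty. *)
Lemma uniq_paddings (r s : seq pdiag) : all nonempty r -> all nonempty s ->
  uniq (paddings r s).
Proof.
have cinj (c : pdiag * pdiag) : injective (cons c) by move=> u v [].
elim: r s => [|a r IHr] s /=.
  elim: s => [|b s IHs] //= _ /andP[nb hs].
  by rewrite map_inj_uniq ?IHs.
case/andP=> na hr; elim: s => [|b s IHs] /= hs.
  by rewrite map_inj_uniq ?IHr.
have /andP[nb hs'] := hs.
rewrite !cat_uniq !map_inj_uniq ?IHr //= IHs // ?andbT.
have disj c d (L L' : seq (seq (pdiag * pdiag))) : c != d ->
    ~~ has (mem (map (cons c) L)) (map (cons d) L').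
  move=> cd; apply/hasPn => _ /mapP[w _ ->] /=.
  by rewrite mem_map_cons eq_sym (negbTE cd).
rewrite has_cat negb_or !disj //; rewrite xpair_eqE negb_and.
- by rewrite eq_sym -/(nonempty a) na.
- by rewrite orbC eq_sym -/(nonempty b) nb.
- by rewrite -/(nonempty a) na.
Qed.

Lemma all_letter_nonempty (s : seq pdiag) : all letter s -> all nonempty s.
Proof. by apply: sub_all => p /andP[]. Qed.

(** [is_padding] is invariant under reversal, although the recursion of [paddings] is not. Hence the
    product also has a recursion on last letters. *)
Lemma perm_rev_paddings (r s : seq pdiag) : all nonempty r -> all nonempty s ->
  perm_eq (map rev (paddings r s)) (paddings (rev r) (rev s)).
Proof.
move=> hr hs; have hr' : all nonempty (rev r) by rewrite all_rev.
have hs' : all nonempty (rev s) by rewrite all_rev.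
apply: uniq_perm; rewrite ?(map_inj_uniq (inv_inj revK)) ?uniq_paddings //.
move=> w; rewrite -{1}(revK w) (mem_map (inv_inj revK)) !mem_paddings //.
rewrite /is_padding /unzip1 /unzip2 !map_rev !filter_rev all_rev.
by rewrite !(inv_eq revK).
Qed.

Lemma padded_factorizationE (s r : seq pdiag) : all letter r ->
  padded_factorization s (bigtens r) = (filter nonempty s == r).
Proof.
move=> lr; rewrite /padded_factorization; apply/andP/eqP => [[hi /eqP E]|->].
  apply: bigtens_letter_inj => //; apply/allP => p ps.
  by rewrite /letter (allP hi) // andbT; move: ps; rewrite mem_filter => /andP[].
by rewrite eqxx; split=> //; apply: sub_all lr => p /andP[].
Qed.

Lemma product_indexE (r s : seq pdiag) w : all letter r -> all letter s ->
  product_index (bigtens r) (bigtens s) w = is_padding r s w.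
Proof.
move=> lr ls; rewrite /product_index !padded_factorizationE //.
rewrite /is_padding /bullets all_map; congr [&& _, _ & _].
by apply: eq_all => x /=; rewrite nonempty_bullet.
Qed.

Lemma pdiag_of_bdiag_inj N : injective (@pdiag_of_bdiag N).
Proof.
move=> [i P] [j Q] /= E; have ij : i = j.
  by apply: val_inj; apply: (congr1 order E).
subst j; congr existT; move: E; rewrite /pdiag_of_bdiag /= => E.
exact: (eq_from_Tagged E).
Qed.

(** * Antipode of a quasi-shuffle algebra *)

Local Open Scope ring_scope.

Section AntipodeRecursion.
Variables (V : zmodType) (T : Type) (dot : T -> T -> T) (is_letter : pred T).
Variables (op : T -> V -> V) (mul : V -> V -> V) (one : V).

Hypothesis dotA : associative dot.
Hypothesis letter_dot : forall x y,
  is_letter x -> is_letter y -> is_letter (dot x y).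
Hypothesis op_add : forall x u v, op x (u + v) = op x u + op x v.
Hypothesis op_opp : forall x u, op x (- u) = - op x u.
Hypothesis mul_addl : forall u v w, mul (u + v) w = mul u w + mul v w.
Hypothesis mul_oppl : forall u w, mul (- u) w = - mul u w.
Hypothesis mul1v : left_id one mul.
Hypothesis mulv1 : right_id one mul.
Hypothesis mul_op : forall x y X Y, is_letter x -> is_letter y ->
  mul (op x X) (op y Y)
  = op x (mul X (op y Y)) + op y (mul (op x X) Y) + op (dot x y) (mul X Y).

(* Words are read from right to left: [antipode_cons x u] is the antipode of the
   word with last letter [x] preceded by the letters of [u] in reverse. *)
Fixpoint antipode_cons (x : T) (u : seq T) : V :=
  if u is z :: u' then
    - op x (antipode_cons z u') - antipode_cons (dot z x) u'
  else - op x one.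

Definition antipode_word (u : seq T) : V :=
  if u is x :: u' then antipode_cons x u' else one.

Definition word (s : seq T) : V := foldr op one s.

(* The part of [antipode_cons x u * Y] whose first letter comes from the left
   factor alone. *)
Fixpoint antipode_head (x : T) (u : seq T) (Y : V) : V :=
  if u is z :: u' then
    - op x (mul (antipode_cons z u') Y) - antipode_head (dot z x) u' Y
  else - op x Y.

(** The product is sorted by the origin of its first letter. The second summand is
    [- antipode_head y (x :: u) Y], so that consecutive terms of the convolution cancel.
    Associativity of [dot] matches the letters merged on either side of [x]. *)
Lemma mul_antipode_op x y u Y : is_letter x -> is_letter y -> all is_letter u ->
  mul (antipode_cons x u) (op y Y)
  = antipode_head x u (op y Y)
    + (op y (mul (antipode_cons x u) Y) + antipode_head (dot x y) u Y).
Proof.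
elim: u x => [|z u IH] x lx ly /=.
  by rewrite !mul_oppl mul_op // !mul1v op_opp !opprD addrA.
case/andP=> lz lu; rewrite !mul_addl !mul_oppl mul_op // (IH (dot z x)) ?letter_dot //.
rewrite op_add !op_opp dotA !opprD -!addrA.
set a := op x _; set b := op y _; set c := op (dot x y) _.
set d := antipode_head _ _ _; set e := op y _; set f := antipode_head _ _ _.
by congr (- a + _); rewrite [RHS]addrCA; congr (_ + _);
  rewrite [LHS]addrCA; congr (_ + _); rewrite addrCA.
Qed.

(** A tail of the convolution sum of the word [rev u ++ v]: only the cuts at the end of [rev u] or
    later are kept. A general [u] is needed for the telescoping induction. *)
Fixpoint antipode_convolution (u v : seq T) : V :=
  mul (antipode_word u) (word v)
  + (if v is y :: v' then antipode_convolution (y :: u) v' else 0).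

Lemma antipode_head1 x u : antipode_head x u one = antipode_cons x u.
Proof. by elim: u x => [|z u IH] x //=; rewrite mulv1 IH. Qed.

(* By [mul_antipode_op] the sum telescopes. *)
Lemma antipode_convolutionE x u v : all is_letter (x :: u) -> all is_letter v ->
  antipode_convolution (x :: u) v = antipode_head x u (word v).
Proof.
elim: v x u => [|y v IH] x u lu lv.
  by rewrite /= mulv1 addr0 antipode_head1.
have /andP[ly lv'] := lv; have /andP[lx lu'] := lu.
rewrite [LHS]/= IH //=; last by rewrite ly lx.
by rewrite mul_antipode_op //= -opprD -addrA subrr addr0.
Qed.

(** The cut before [y] contributes [op y (word v)]; the others add up to [antipode_head y [::] (word
    v)], its opposite. *)
Lemma antipode_convolution_eq0 y v : all is_letter (y :: v) ->
  antipode_convolution [::] (y :: v) = 0.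
Proof.
move=> lv; have /andP[ly lv'] := lv.
by rewrite [LHS]/= antipode_convolutionE ?/= ?ly // mul1v subrr.
Qed.

Lemma antipode_convolution_sum u v : antipode_convolution u v =
  \sum_(i < (size v).+1) mul (antipode_word (catrev (take i v) u)) (word (drop i v)).
Proof.
elim: v u => [|y v IH] u /=; first by rewrite big_ord_recl big_ord0.
rewrite IH [RHS]big_ord_recl; congr (_ + _); exact: eq_bigr.
Qed.

End AntipodeRecursion.

(** * The antipode recursion read from the other end *)

Section AntipodeReversal.
Variables (V : zmodType) (T : Type) (dot : T -> T -> T).
Variables (opl opr : T -> V -> V) (one : V).
Hypothesis dotA : associative dot.
Hypothesis opr_add : forall x u v, opr x (u + v) = opr x u + opr x v.
Hypothesis opl_opp : forall x u, opl x (- u) = - opl x u.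
Hypothesis opr_opp : forall x u, opr x (- u) = - opr x u.
Hypothesis opl_add : forall x u v, opl x (u + v) = opl x u + opl x v.
Hypothesis oplr : forall x y v, opl x (opr y v) = opr y (opl x v).
Hypothesis op1 : forall x, opl x one = opr x one.

Local Notation antl := (antipode_cons dot opl one).
Local Notation antr := (antipode_cons (fun x y => dot y x) opr one).

Lemma antipode_cons_rcons1 x d :
  antl x [:: d] = - opr d (antl x [::]) - antl (dot d x) [::].
Proof. by rewrite /= opl_opp opr_opp !opprK op1 oplr op1. Qed.

(** The two-letter word is treated apart: merging its letters leaves no letter before the merged
    one. *)
Lemma antipode_cons_rcons x u c d : antl x (rcons (rcons u c) d) =
  - opr d (antl x (rcons u c)) - antl x (rcons u (dot d c)).
Proof.
elim: u x => [|z u IH] x.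
  have -> : antl x (rcons (rcons [::] c) d)
    = - opl x (antl c [:: d]) - antl (dot c x) [:: d] by [].
  rewrite !antipode_cons_rcons1 /=.
  rewrite !(opl_opp, opr_opp, opl_add, opr_add, opprD, opprK) dotA !oplr.
  rewrite (op1 c) (op1 (dot d c)) !oplr -!addrA; congr (_ + _); exact: addrCA.
rewrite /= !IH.
rewrite !(opl_opp, opr_opp, opl_add, opr_add, opprD, opprK) !oplr.
by rewrite -!addrA; congr (_ + _); rewrite addrCA.
Qed.

Lemma antipode_word_rev s :
  antipode_word (fun x y => dot y x) opr one s
  = antipode_word dot opl one (rev s).
Proof.
case: s => [|x s] //; rewrite [LHS]/=; elim: s x => [|z s IH] x.
  by rewrite /= op1.
rewrite [LHS]/= !IH !rev_cons; case: (rev s) => [|y u].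
  exact/esym/antipode_cons_rcons1.
exact/esym/antipode_cons_rcons.
Qed.
End AntipodeReversal.

(** * Quasi-shuffle recursion in ParQSym *)

Section LinearExtension.
Variable K : fieldType.

(** Allows vectors with different supports to be summed over a common one, as linearity requires. *)
Lemma linextEw (B : choiceType) (V : lmodType K) (f : B -> V)
    (v : {malg K[B]}) (d : {fset B}) : (msupp v `<=` d)%fset ->
  linext f v = \sum_(b <- d) v@_b *: f b.
Proof.
move=> /fsubsetP vd; rewrite /linext.
rewrite [RHS](bigID (mem (msupp v))) /= [X in _ + X]big1 ?addr0; last first.
  by move=> b /mcoeff_outdom ->; rewrite scale0r.
rewrite -[RHS]big_filter; apply: perm_big; apply: uniq_perm.
- exact: fset_uniq.
- by rewrite filter_uniq ?fset_uniq.
move=> b; rewrite mem_filter; case: (boolP (b \in msupp v)) => //= /vd.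
by move->.
Qed.

Lemma linext_is_linear (B : choiceType) (V : lmodType K) (f : B -> V) :
  linear (linext f).
Proof.
move=> c u v; pose d := (msupp u `|` msupp v)%fset.
have du : (msupp u `<=` d)%fset by apply: fsubsetUl.
have dv : (msupp v `<=` d)%fset by apply: fsubsetUr.
have dcuv : (msupp (c *: u + v) `<=` d)%fset.
  apply: fsubset_trans (msuppD_le _ _) _; rewrite fsubUset dv andbT.
  exact: fsubset_trans (msuppZ_le _ _) du.
rewrite (linextEw _ dcuv) (linextEw _ du) (linextEw _ dv).
rewrite scaler_sumr -big_split; apply: eq_bigr => b _ /=.
by rewrite mcoeffD mcoeffZ scalerDl scalerA.
Qed.

HB.instance Definition _ (B : choiceType) (V : lmodType K) (f : B -> V) :=
  GRing.isLinear.Build K {malg K[B]} V _ (linext f) (linext_is_linear f).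

Lemma linextU (B : choiceType) (V : lmodType K) (f : B -> V) (b : B) :
  linext f (<< b >> : {malg K[B]}) = f b.
Proof. by rewrite /linext msuppU oner_eq0 big_seq_fset1 mcoeffUU scale1r. Qed.

Lemma linext_id (B : choiceType) (v : {malg K[B]}) :
  linext (fun b => << b >> : {malg K[B]}) v = v.
Proof.
rewrite [RHS]monalgE /linext; apply: eq_bigr => b _.
by apply/malgP => b'; rewrite mcoeffZ !mcoeffU; case: eqP; rewrite ?mulr0 ?mulr1.
Qed.

Lemma linear_malgE (B : choiceType) (V : lmodType K) (f : {malg K[B]} -> V) :
  linear f -> forall v, f v = linext (fun b => f << b >>) v.
Proof.
move=> lf v; pose F := GRing.isLinear.Build K {malg K[B]} V _ f lf.
pose g : {linear {malg K[B]} -> V} := HB.pack f F.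
rewrite -{1}(linext_id v) -[f _]/(g _) linear_sum; apply: eq_bigr => b _.
by rewrite linearZ.
Qed.

Lemma linear_malg_ext (B : choiceType) (V : lmodType K) (f g : {malg K[B]} -> V) :
  linear f -> linear g -> (forall b, f << b >> = g << b >>) -> f =1 g.
Proof.
move=> lf lg fg v; rewrite (linear_malgE lf) (linear_malgE lg).
by apply: eq_bigr => b _; rewrite fg.
Qed.

End LinearExtension.

(** * The product on words of letters *)

Section Bialgebra.
Variable K : fieldType.
Local Notation H := (ParQSym K).
Local Notation M := (@M K).
Local Notation product := (@product K).

Lemma productMM p q : product (M p) (M q) = product_basis K p q.
Proof. by rewrite /product /M !linextU. Qed.

Lemma linear_product_l (v : H) : linear (product^~ v).
Proof. exact: linext_is_linear. Qed.

Lemma linear_product_r (u : H) : linear (product u).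
Proof.
move=> c v w; rewrite /product /linext scaler_sumr -big_split.
apply: eq_bigr => p _ /=; rewrite -/(linext _ _) -/(linext _ v) -/(linext _ w).
by rewrite linext_is_linear scalerDr !scalerA mulrC.
Qed.

(** Prepending and appending a letter: the two instances of [op] in the abstract recursion. *)
Definition tensl (a : pdiag) : H -> H := linext (fun p => M (tens a p)).
Definition tensr (a : pdiag) : H -> H := linext (fun p => M (tens p a)).

Lemma linear_tensl a : linear (tensl a). Proof. exact: linext_is_linear. Qed.
Lemma linear_tensr a : linear (tensr a). Proof. exact: linext_is_linear. Qed.

Local Opaque tens bullet.

Definition shuffle (r s : seq pdiag) : H :=
  \sum_(w <- paddings r s) M (bigtens (bullets w)).

Lemma pdiag2_of_bdiag2_inj N : injective (@pdiag2_of_bdiag2 N).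
Proof.
move=> [a b] [c d] E; congr pair; apply: pdiag_of_bdiag_inj.
  exact: (congr1 fst E).
exact: (congr1 snd E).
Qed.

(** By [product_index_bound], the bounds in [product_basis] lose no padding. *)
Lemma product_bigtens r s : all letter r -> all letter s ->
  product (M (bigtens r)) (M (bigtens s)) = shuffle r s.
Proof.
move=> lr ls; rewrite productMM /product_basis /shuffle.
apply: (@sum_tuples_seq _ _ _ (@pdiag2_of_bdiag2 _) _
  (product_index (bigtens r) (bigtens s)) (fun w => M (bigtens (bullets w)))).
- exact: pdiag2_of_bdiag2_inj.
- by rewrite uniq_paddings ?all_letter_nonempty.
- by move=> w; rewrite mem_paddings ?all_letter_nonempty // product_indexE.
- exact: product_index_bound.
Qed.

Lemma tenslM a p : tensl a (M p) = M (tens a p).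
Proof. exact: linextU. Qed.
Lemma tensrM a p : tensr a (M p) = M (tens p a).
Proof. exact: linextU. Qed.

Lemma tensl_sum a (I : Type) (w : seq I) (F : I -> H) :
  tensl a (\sum_(i <- w) F i) = \sum_(i <- w) tensl a (F i).
Proof. exact: linear_sum. Qed.
Lemma tensr_sum a (I : Type) (w : seq I) (F : I -> H) :
  tensr a (\sum_(i <- w) F i) = \sum_(i <- w) tensr a (F i).
Proof. exact: linear_sum. Qed.

Lemma M_bigtens_cons a s : M (bigtens (a :: s)) = tensl a (M (bigtens s)).
Proof. by rewrite tenslM. Qed.

Lemma sum_bullets_consl (c : pdiag * pdiag) (L : seq (seq (pdiag * pdiag))) :
  \sum_(w <- map (cons c) L) M (bigtens (bullets w))
  = tensl (bullet c.1 c.2) (\sum_(w <- L) M (bigtens (bullets w))).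
Proof.
by rewrite big_map tensl_sum; apply: eq_bigr => w _; rewrite -M_bigtens_cons.
Qed.

Lemma shuffle_consl a r b s : shuffle (a :: r) (b :: s) =
  tensl a (shuffle r (b :: s)) + tensl b (shuffle (a :: r) s)
  + tensl (bullet a b) (shuffle r s).
Proof.
by rewrite /shuffle paddingscc !big_cat !sum_bullets_consl bulletp0 bullet0p -[RHS]addrA.
Qed.

Lemma shuffle0s s : shuffle [::] s = M (bigtens s).
Proof.
rewrite /shuffle; elim: s => [|b s IH]; first exact: big_seq1.
by rewrite paddings0c sum_bullets_consl IH bullet0p M_bigtens_cons.
Qed.

Lemma shuffles0 r : shuffle r [::] = M (bigtens r).
Proof.
rewrite /shuffle; elim: r => [|a r IH]; first exact: big_seq1.
by rewrite paddingsc0 sum_bullets_consl IH bulletp0 M_bigtens_cons.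
Qed.

Lemma shuffle_rev r s : all nonempty r -> all nonempty s ->
  shuffle (rev r) (rev s)
  = \sum_(w <- paddings r s) M (bigtens (rev (bullets w))).
Proof.
move=> nr ns; rewrite /shuffle -(perm_big _ (perm_rev_paddings nr ns)) big_map.
by apply: eq_bigr => w _; rewrite /bullets map_rev.
Qed.

Lemma bigtens_rcons s a : bigtens (rcons s a) = tens (bigtens s) a.
Proof. by rewrite -cats1 bigtens_cat /= tensp0. Qed.

Lemma M_bigtens_rcons a s : M (bigtens (rcons s a)) = tensr a (M (bigtens s)).
Proof. by rewrite tensrM bigtens_rcons. Qed.

Lemma sum_bullets_consr (c : pdiag * pdiag) (L : seq (seq (pdiag * pdiag))) :
  \sum_(w <- map (cons c) L) M (bigtens (rev (bullets w)))
  = tensr (bullet c.1 c.2) (\sum_(w <- L) M (bigtens (rev (bullets w)))).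
Proof.
rewrite big_map tensr_sum; apply: eq_bigr => w _.
by rewrite -M_bigtens_rcons -rev_cons.
Qed.

Lemma shuffle_consr a r b s : nonempty a -> nonempty b ->
    all nonempty r -> all nonempty s ->
  shuffle (rcons r a) (rcons s b) =
  tensr a (shuffle r (rcons s b)) + tensr b (shuffle (rcons r a) s)
  + tensr (bullet a b) (shuffle r s).
Proof.
move=> na nb nr ns; rewrite -(revK r) -(revK s) -!rev_cons.
have nr' : all nonempty (rev r) by rewrite all_rev.
have ns' : all nonempty (rev s) by rewrite all_rev.
have nra : all nonempty (a :: rev r) by apply/andP.
have nsb : all nonempty (b :: rev s) by apply/andP.
rewrite !shuffle_rev // paddingscc !big_cat !sum_bullets_consr.
by rewrite bulletp0 bullet0p -[RHS]addrA.
Qed.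

Lemma product1v : left_id (M empty_diag) product.
Proof.
apply: linear_malg_ext => [|//|p]; first exact: linear_product_r.
rewrite -[<< p >>]/(M p) -(factorizationK p) -[empty_diag]/(bigtens [::]).
by rewrite product_bigtens ?factorization_letter // shuffle0s.
Qed.

Lemma productv1 : right_id (M empty_diag) product.
Proof.
apply: linear_malg_ext => [|//|p]; first exact: linear_product_l.
rewrite -[<< p >>]/(M p) -(factorizationK p) -[empty_diag]/(bigtens [::]).
by rewrite product_bigtens ?factorization_letter // shuffles0.
Qed.

Lemma linear_comp (U V W : lmodType K) (f : V -> W) (g : U -> V) :
  linear f -> linear g -> linear (fun x => f (g x)).
Proof. by move=> lf lg c u v; rewrite lg lf. Qed.

Lemma linear_add (U V : lmodType K) (f g : U -> V) :
  linear f -> linear g -> linear (fun x => f x + g x).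
Proof. by move=> lf lg c u v; rewrite lf lg scalerDr addrACA. Qed.

(** Both sides are linear in [X] and in [Y], so basis vectors suffice. *)
Lemma product_op_ext (op : pdiag -> H -> H) a b :
    (forall x, linear (op x)) ->
    (forall p q, let X := M p in let Y := M q in
      product (op a X) (op b Y) = op a (product X (op b Y))
        + op b (product (op a X) Y) + op (bullet a b) (product X Y)) ->
  forall X Y, product (op a X) (op b Y) = op a (product X (op b Y))
        + op b (product (op a X) Y) + op (bullet a b) (product X Y).
Proof.
move=> lop h X Y; move: X; apply: linear_malg_ext.
- exact: (linear_comp (linear_product_l _) (lop a)).
- apply: linear_add; first apply: linear_add.
  + exact: (linear_comp (lop a) (linear_product_l _)).
  + exact: (linear_comp (lop b) (linear_comp (linear_product_l _) (lop a))).
  + exact: (linear_comp (lop _) (linear_product_l _)).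
move=> p; move: Y; apply: linear_malg_ext.
- exact: (linear_comp (linear_product_r _) (lop b)).
- apply: linear_add; first apply: linear_add.
  + exact: (linear_comp (lop a) (linear_comp (linear_product_r _) (lop b))).
  + exact: (linear_comp (lop b) (linear_product_r _)).
  + exact: (linear_comp (lop _) (linear_product_r _)).
exact: h.
Qed.

Lemma product_tensl a b X Y : letter a -> letter b ->
  product (tensl a X) (tensl b Y) = tensl a (product X (tensl b Y))
    + tensl b (product (tensl a X) Y) + tensl (bullet a b) (product X Y).
Proof.
move=> la lb; apply: product_op_ext => [x|p q /=]; first exact: linear_tensl.
rewrite -(factorizationK p) -(factorizationK q) -!M_bigtens_cons.
have lp := factorization_letter p; have lq := factorization_letter q.
have lpa : all letter (a :: factorization p) by apply/andP.
have lqb : all letter (b :: factorization q) by apply/andP.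
apply: etrans (product_bigtens lpa lqb) _.
apply: etrans (shuffle_consl _ _ _ _) (esym _).
exact (f_equal2 +%R (f_equal2 +%R
  (congr1 (tensl a) (product_bigtens lp lqb))
  (congr1 (tensl b) (product_bigtens lpa lq)))
  (congr1 (tensl (bullet a b)) (product_bigtens lp lq))).
Qed.

Lemma product_tensr a b X Y : letter a -> letter b ->
  product (tensr a X) (tensr b Y) = tensr a (product X (tensr b Y))
    + tensr b (product (tensr a X) Y) + tensr (bullet a b) (product X Y).
Proof.
move=> la lb; apply: product_op_ext => [x|p q /=]; first exact: linear_tensr.
rewrite -(factorizationK p) -(factorizationK q) -!M_bigtens_rcons.
have lp := factorization_letter p; have lq := factorization_letter q.
have lpa : all letter (rcons (factorization p) a) by rewrite all_rcons la.
have lqb : all letter (rcons (factorization q) b) by rewrite all_rcons lb.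
have [na _] := andP la; have [nb _] := andP lb.
apply: etrans (product_bigtens lpa lqb) _.
apply: etrans (shuffle_consr na nb (all_letter_nonempty lp)
  (all_letter_nonempty lq)) (esym _).
exact (f_equal2 +%R (f_equal2 +%R
  (congr1 (tensr a) (product_bigtens lp lqb))
  (congr1 (tensr b) (product_bigtens lpa lq)))
  (congr1 (tensr (bullet a b)) (product_bigtens lp lq))).
Qed.
End Bialgebra.

(** * The antipode of ParQSym *)

Section Antipode.
Variable K : fieldType.
Local Notation H := (ParQSym K).
Local Notation M := (@M K).
Local Notation product := (@product K).

Lemma linear_addE (U V : lmodType K) (f : U -> V) :
  linear f -> forall u v, f (u + v) = f u + f v.
Proof. by move=> lf u v; rewrite -{1}(scale1r u) lf scale1r. Qed.

Lemma linear_oppE (U V : lmodType K) (f : U -> V) :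
  linear f -> forall u, f (- u) = - f u.
Proof.
move=> lf u; have f0 : f 0 = 0.
  by apply: (addrI (f 0)); rewrite -linear_addE // !addr0.
by apply/eqP; rewrite -addr_eq0 -linear_addE // addNr f0.
Qed.

Lemma word_tensl s : word (@tensl K) (M empty_diag) s = M (bigtens s).
Proof.
elim: s => [|a s IH]; first by [].
exact: etrans (congr1 (tensl a) IH) (tenslM _ _ _).
Qed.

Lemma word_tensr s : word (@tensr K) (M empty_diag) s = M (bigtens (rev s)).
Proof.
elim: s => [|a s IH]; first by [].
rewrite rev_cons; apply: etrans (congr1 (tensr a) IH) _.
exact/esym/M_bigtens_rcons.
Qed.

Lemma all_take (T : Type) (a : pred T) i (s : seq T) : all a s -> all a (take i s).
Proof. by rewrite -{1}(cat_take_drop i s) all_cat => /andP[]. Qed.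

Lemma all_drop (T : Type) (a : pred T) i (s : seq T) : all a s -> all a (drop i s).
Proof. by rewrite -{1}(cat_take_drop i s) all_cat => /andP[]. Qed.

Definition antipode_basis (p : pdiag) : H :=
  antipode_word bullet (@tensl K) (M empty_diag) (rev (factorization p)).
Definition antipode : H -> H := linext antipode_basis.

Lemma antipode_bigtens s : all letter s -> antipode (M (bigtens s)) =
  antipode_word bullet (@tensl K) (M empty_diag) (rev s).
Proof.
move=> ls; apply: etrans (linextU _ _) _.
by rewrite /antipode_basis bigtensK.
Qed.

Lemma coproduct_bigtens s : all letter s -> coproduct (M (bigtens s)) =
  \sum_(i < (size s).+1) M2 K (bigtens (take i s)) (bigtens (drop i s)).
Proof.
move=> ls; apply: etrans (linextU _ _) _; rewrite /coproduct_basis.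
rewrite -(big_mkord xpredT
  (fun i => M2 K (bigtens (take i s)) (bigtens (drop i s)))).
rewrite /index_iota subn0.
pose g i := (bigtens (take i s), bigtens (drop i s)).
rewrite -(big_map g xpredT (fun x => M2 K x.1 x.2)).
apply: (@sum_reindex_seq _ _ _ (@pdiag2_of_bdiag2 (order (bigtens s)))
  (fun x => tens x.1 x.2 == bigtens s) (fun x => M2 K x.1 x.2)).
- exact: pdiag2_of_bdiag2_inj.
(* Distinct cuts give distinct pairs, since their left factors have different numbers of letters. *)
- rewrite map_inj_in_uniq ?iota_uniq // => i j.
  rewrite !mem_iota !add0n !ltnS => /= hi hj [E _].
  have : take i s = take j s.
    by apply: bigtens_letter_inj E; apply: all_take.
  by move/(congr1 size); rewrite !size_takel.
- move=> [x y]; apply/idP/eqP => [/mapP[i _ [-> ->]]|].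
    exact/esym/(etrans _ (bigtens_cat _ _))/(congr1 bigtens)/esym/cat_take_drop.
  case/(tens_eq_bigtens x y ls) => i hi [-> ->].
  by apply: (map_f g); rewrite mem_iota.
move=> [x y] /eqP E.
have [|x' ->] := @bdiagP (order (bigtens s)) x; first by rewrite -E leq_addr.
have [|y' ->] := @bdiagP (order (bigtens s)) y; first by rewrite -E leq_addl.
by exists (x', y').
Qed.

Lemma convolution_bigtens f g s : all letter s ->
  convolution f g (M (bigtens s)) = \sum_(i < (size s).+1)
    product (f (M (bigtens (take i s)))) (g (M (bigtens (drop i s)))).
Proof.
move=> ls; rewrite /convolution coproduct_bigtens // linear_sum.
by apply: eq_bigr => i _; apply: etrans (linextU _ _) _.
Qed.

Lemma counitM p : counit (M p) = (p == empty_diag)%:R.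
Proof. exact: (@linextU _ _ K^o). Qed.

Lemma linear_convolution f g : linear (@convolution K f g).
Proof.
exact: (linear_comp (linext_is_linear _) (linext_is_linear _)).
Qed.

Lemma linear_counit_unit : linear (fun v : H => counit v *: M empty_diag).
Proof.
move=> c u v; rewrite scalerA -scalerDl; congr (_ *: _).
exact: (@linext_is_linear _ _ K^o).
Qed.

Lemma convolution_antipodel v :
  convolution antipode id v = counit v *: M empty_diag.
Proof.
move: v; apply: linear_malg_ext;
  [exact: linear_convolution | exact: linear_counit_unit | move=> p].
have ls := factorization_letter p.
rewrite -[<< p >>]/(M p) -(factorizationK p) convolution_bigtens // counitM.
transitivity (antipode_convolution bullet (@tensl K) product (M empty_diag) [::]
  (factorization p)).
  rewrite antipode_convolution_sum; apply: eq_bigr => i _.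
  rewrite antipode_bigtens; last exact: all_take.
  by rewrite word_tensl.
move: ls; case: (factorization p) => [|a s] ls.
  by rewrite /= eqxx scale1r product1v addr0.
rewrite (antipode_convolution_eq0 (is_letter := letter)) //.
- have -> : (bigtens (a :: s) == empty_diag) = false.
    apply/eqP => /tens_eq0[a0 _].
    by case/andP: ls; rewrite /letter a0 nonempty_empty.
  by rewrite scale0r.
- exact: bulletA.
- exact: letter_bullet.
- by move=> x; apply: linear_addE; apply: linear_tensl.
- by move=> x; apply: linear_oppE; apply: linear_tensl.
- by move=> u w x; apply: (linear_addE (linear_product_l x)).
- by move=> u x; apply: (linear_oppE (linear_product_l x)).
- exact: product1v.
- exact: productv1.
- by move=> x y X Y lx ly; apply: product_tensl.
Qed.

Lemma antipode_word_tensr s :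
  antipode_word (fun x y => bullet y x) (@tensr K) (M empty_diag) s
  = antipode_word bullet (@tensl K) (M empty_diag) (rev s).
Proof.
apply: antipode_word_rev.
- exact: bulletA.
- by move=> x; apply: linear_addE; apply: linear_tensr.
- by move=> x; apply: linear_oppE; apply: linear_tensl.
- by move=> x; apply: linear_oppE; apply: linear_tensr.
- by move=> x; apply: linear_addE; apply: linear_tensl.
- move=> x y; apply: linear_malg_ext.
  + exact: (linear_comp (linear_tensl x) (linear_tensr y)).
  + exact: (linear_comp (linear_tensr y) (linear_tensl x)).
  move=> q; apply: etrans (congr1 (tensl x) (tensrM _ y q)) _.
  apply: etrans (tenslM _ _ _) _; rewrite tensA.
  apply: esym; apply: etrans (congr1 (tensr y) (tenslM _ x q)) _.
  exact: tensrM.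
- move=> x; apply: etrans (tenslM _ _ _) _; apply: esym.
  by apply: etrans (tensrM _ _ _) _; rewrite tens0p tensp0.
Qed.

(** The left-inverse computation is applied to the mirrored data: reversed words, [tensr], the
    opposite product and the opposite [bullet]. By [antipode_word_tensr] the mirrored recursion
    yields the same map. *)
Lemma convolution_antipoder v :
  convolution id antipode v = counit v *: M empty_diag.
Proof.
move: v; apply: linear_malg_ext;
  [exact: linear_convolution | exact: linear_counit_unit | move=> p].
have ls := factorization_letter p.
rewrite -[<< p >>]/(M p) -(factorizationK p) convolution_bigtens // counitM.
transitivity (antipode_convolution (fun x y => bullet y x) (@tensr K)
  (fun X Y => product Y X) (M empty_diag) [::] (rev (factorization p))).
  (* The cut after [i] letters of the reversed word is the cut before the last [i] letters of the
     word. *)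
  rewrite antipode_convolution_sum size_rev [RHS](reindex_inj rev_ord_inj).
  apply: eq_bigr => i _; have hi : (i <= size (factorization p))%N by rewrite -ltnS.
  have -> : rev_ord i = (size (factorization p) - i)%N :> nat by rewrite /= subSS.
  have -> : catrev (take (size (factorization p) - i) (rev (factorization p))) [::]
      = drop i (factorization p).
    by rewrite -/(rev _) take_rev revK subKn.
  rewrite drop_rev (subKn hi) word_tensr revK.
  rewrite (antipode_bigtens (all_drop i ls)).
  exact: (congr1 (product _) (esym (antipode_word_tensr _))).
have : all letter (rev (factorization p)) by rewrite all_rev.
rewrite -{3}(revK (factorization p)).
case: (rev (factorization p)) => [|a s] lr.
  by rewrite /rev /= eqxx scale1r product1v addr0.
rewrite (antipode_convolution_eq0 (is_letter := letter)) //.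
- have -> : (bigtens (rev (a :: s)) == empty_diag) = false.
    rewrite rev_cons bigtens_rcons; apply/eqP => /tens_eq0[_ a0].
    by case/andP: lr; rewrite /letter a0 nonempty_empty.
  by rewrite scale0r.
- by move=> x y z; rewrite bulletA.
- by move=> x y lx ly; apply: letter_bullet.
- by move=> x; apply: linear_addE; apply: linear_tensr.
- by move=> x; apply: linear_oppE; apply: linear_tensr.
- by move=> u w x; apply: (linear_addE (linear_product_r x)).
- by move=> u x; apply: (linear_oppE (linear_product_r x)).
- exact: productv1.
- exact: product1v.
(* In the opposite product the first two terms of the recursion are exchanged. *)
move=> x y X Y lx ly; apply: etrans (product_tensr _ _ ly lx) _.
exact (congr1 (fun z => z + _) (addrC _ _)).
Qed.
End Antipode.

(** * The span of the diagrams of propagation number 0 *)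

Section Prop0.
Variable K : fieldType.
Local Notation H := (ParQSym K).
Local Notation M := (@M K).
Local Notation product := (@product K).

Lemma span_subspace (V : lmodType K) (X : V -> Prop) : is_subspace (span X).
Proof.
split; first by exists [::] => //; rewrite big_nil.
move=> c u v [s hs ->] [t ht ->].
exists ([seq (c * x.1, x.2) | x <- s] ++ t) => [cx|].
  by rewrite mem_cat => /orP[/mapP[x /hs hx ->]|/ht].
rewrite big_cat big_map scaler_sumr; congr (_ + _).
by apply: eq_bigr => x _; rewrite scalerA.
Qed.

Lemma span_gen (V : lmodType K) (X : V -> Prop) v : X v -> span X v.
Proof.
move=> hv; exists [:: (1, v)] => [cx|]; first by rewrite inE => /eqP ->.
by rewrite big_seq1 scale1r.
Qed.

Section Subspace.
Variables (V : lmodType K) (A : V -> Prop).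
Hypothesis subA : is_subspace A.

Lemma subspace_add u v : A u -> A v -> A (u + v).
Proof. by move=> hu hv; rewrite -(scale1r u); apply: subA.2. Qed.

Lemma subspace_scale c u : A u -> A (c *: u).
Proof. by move=> hu; rewrite -[_ *: _]addr0; apply: subA.2 => //; apply: subA.1. Qed.

Lemma subspace_opp u : A u -> A (- u).
Proof. by rewrite -scaleN1r; apply: subspace_scale. Qed.

Lemma subspace_sum (I : eqType) (s : seq I) (P : pred I) (F : I -> V) :
  (forall i, i \in s -> P i -> A (F i)) -> A (\sum_(i <- s | P i) F i).
Proof.
move=> h; rewrite big_seq_cond; apply: big_ind; first exact: subA.1.
  exact: subspace_add.
by move=> i /andP[/h].
Qed.

Lemma subspace_linext (B : choiceType) (f : B -> V) (v : {malg K[B]}) :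
  (forall b, b \in msupp v -> A (f b)) -> A (linext f v).
Proof.
by move=> h; apply: subspace_sum => b hb _; apply: subspace_scale; apply: h.
Qed.
End Subspace.

Local Notation A := (@ParQSym_prop0 K).

Lemma prop0_subspace : is_subspace A.
Proof. exact: span_subspace. Qed.

Lemma prop0_M p : propagation_number p = 0%N -> A (M p).
Proof. by move=> hp; apply: span_gen; exists p. Qed.

(** The support of a combination lies in the union of the supports. With [subspace_linext],
    stability under a linear map reduces to basis diagrams of propagation number 0. *)
Lemma prop0_msupp v : A v -> forall p, p \in msupp v -> propagation_number p = 0%N.
Proof.
case=> s + ->; elim: s => [|[c x] s IH] hs p; first by rewrite big_nil msupp0.
rewrite big_cons => /(fsubsetP (msuppD_le _ _)); rewrite in_fsetU => /orP[].
  move/(fsubsetP (msuppZ_le _ _)).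
  have [q q0 /= ->] := hs _ (mem_head _ _).
  by move/(fsubsetP msuppU_le); rewrite in_fset1 => /eqP ->.
by apply: IH => cx h; apply: hs; rewrite inE h orbT.
Qed.

Lemma prop0_tensl a v : propagation_number a = 0%N -> A v -> A (tensl a v).
Proof.
move=> ha /prop0_msupp hv; apply: subspace_linext => [|p /hv hp].
  exact: prop0_subspace.
by apply: prop0_M; apply/propagation0_tens.
Qed.

Lemma prop0_antipode_cons x u : propagation_number x = 0%N ->
    (forall p, p \in u -> propagation_number p = 0%N) ->
  A (antipode_cons bullet (@tensl K) (M empty_diag) x u).
Proof.
have subA := prop0_subspace.
elim: u x => [|z u IH] x hx hu /=.
  by apply: subspace_opp => //; apply: prop0_tensl => //;
    apply: prop0_M; apply: propagation0_empty.
have hz : propagation_number z = 0%N by apply: hu; apply: mem_head.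
have {}hu p : p \in u -> propagation_number p = 0%N.
  by move=> h; apply: hu; rewrite inE h orbT.
apply: subspace_add => //; apply: subspace_opp => //.
  by apply: prop0_tensl => //; apply: IH.
by apply: IH => //; apply: propagation0_bullet.
Qed.

Lemma prop0_antipode v : A v -> A (antipode v).
Proof.
move=> /prop0_msupp hv; apply: subspace_linext => [|p /hv hp].
  exact: prop0_subspace.
have : forall q, q \in rev (factorization p) -> propagation_number q = 0%N.
  move=> q; rewrite mem_rev; move: hp; rewrite -{1}(factorizationK p).
  by move/propagation0_bigtens; apply.
rewrite /antipode_basis; case: (rev _) => [|x u] h.
  by apply: prop0_M; apply: propagation0_empty.
apply: prop0_antipode_cons => [|q hq]; apply: h; rewrite inE ?eqxx //.
by rewrite hq orbT.
Qed.

Lemma propagation0_padded s p : padded_factorization s p ->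
  propagation_number p = 0%N -> forall q, q \in s -> propagation_number q = 0%N.
Proof.
case/andP=> _ /eqP <- /propagation0_bigtens h q qs.
have [nq|/negPn/eqP ->] := boolP (nonempty q); last exact: propagation0_empty.
by apply: h; rewrite mem_filter nq.
Qed.

Lemma prop0_product u v : A u -> A v -> A (product u v).
Proof.
have subA := prop0_subspace.
move=> /prop0_msupp hu /prop0_msupp hv.
apply: subspace_linext => // p /hu hp; apply: subspace_linext => // q /hv hq.
apply: subspace_sum => // k _ _; apply: subspace_sum => // w _.
case/and3P=> /propagation0_padded/(_ hp) h1 /propagation0_padded/(_ hq) h2 _.
apply: prop0_M; apply/propagation0_bigtens => _ /mapP[x xw ->].
by apply: propagation0_bullet; [apply: h1 | apply: h2]; apply: map_f.
Qed.

Lemma tensorMM p q : tensor (M p) (M q) = M2 K p q.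
Proof.
by apply: etrans (linextU _ _) _; apply: etrans (linextU _ _) _.
Qed.

Lemma prop0_coproduct v : A v -> tensor_square A (coproduct v).
Proof.
move=> /prop0_msupp hv; have subA2 : is_subspace (tensor_square A).
  exact: span_subspace.
apply: subspace_linext => // p /hv hp; apply: subspace_sum => // -[a b] _ /eqP /=.
move: (@pdiag_of_bdiag (order p) a) (@pdiag_of_bdiag (order p) b) => q r E.
have [h1 h2] : propagation_number q = 0%N /\ propagation_number r = 0%N.
  by apply/propagation0_tens; rewrite E.
apply: span_gen; exists (M q), (M r).
by split; [exact: prop0_M | exact: prop0_M | rewrite tensorMM].
Qed.

Lemma prop0_homogeneous n v : A v -> A (homogeneous_component n v).
Proof.
move=> /prop0_msupp hv; have subA := prop0_subspace.
apply: subspace_linext => // p /hv hp.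
by case: ifP => _; [apply: prop0_M | case: subA].
Qed.
End Prop0.

Theorem theorem3p2 (K : fieldType) :
  is_graded_subspace (@ParQSym_prop0 K) /\ is_Hopf_subalgebra (@ParQSym_prop0 K).
Proof.
have subA := prop0_subspace K.
split; first by split=> // n v; apply: prop0_homogeneous.
split.
  split=> //.
  - by apply: prop0_M; apply: propagation0_empty.
  - by move=> u v; apply: prop0_product.
  - by move=> v; apply: prop0_coproduct.
exists (@antipode K); last by move=> v; apply: prop0_antipode.
split; first exact: linext_is_linear.
  exact: convolution_antipodel.
exact: convolution_antipoder.
Qed.
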